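(* Let $R$ be a ring with identity and let $L$ be a chain complex of (left) $R$-modules. Then $L$ is a level chain complex if and only if $L$ is exact and, for every $n\in\mathbb{Z}$, the cycle module $Z_nL = \ker(L_n\to L_{n-1})$ is a level $R$-module.
   Context: $R$-modules are left $R$-modules unless stated otherwise; chain complexes are $\mathbb{Z}$-graded and unbounded, with differentials lowering degree. A chain complex is finitely generated if it is bounded and finitely generated in each degree. A (left or right) $R$-module is of type $FP_\infty$ if it has a projective resolution by finitely generated projective modules. A chain complex of (left or right) modules is of type $FP_\infty$ if it has a projective resolution by finitely generated projective complexes (projective objects of the category of chain complexes). For a complex $X$ of right $R$-modules and a complex $Y$ of left $R$-modules, let $X\otimes Y$ be the usual tensor product of complexes. The modified tensor product $X\overline{\otimes}Y$ is the complex of abelian groups whose degree $n$ entry is $(X\otimes Y)_n/B_n(X\otimes Y)$, where $B_n$ denotes the boundaries, with differential $\overline{x\otimes y}\mapsto \overline{dx\otimes y}$. It is right exact in each variable, and its left derived functors are denoted $\overline{\mathrm{Tor}}_i$. A left $R$-module $N$ is level if $\mathrm{Tor}_1^R(M,N)=0$ for all right $R$-modules $M$ of type $FP_\infty$. A chain complex $L$ of left $R$-modules is level if $\overline{\mathrm{Tor}}_1(X,L)=0$ for all chain complexes $X$ of right $R$-modules of type $FP_\infty$. *)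

(* Defs.v *)
From HB Require Import structures.
From mathcomp Require Import all_boot all_order all_algebra.
From mathcomp Require Import boolp.
From mathcomp Require Import freeg.

Set Implicit Arguments.
Unset Strict Implicit.
Unset Printing Implicit Defensive.

Import GRing.Theory.
Local Open Scope ring_scope.

(* Conventions.  A left R-module is an lmodType R; a right R-module is an     *)
(* lmodType R^c, where m . r is written (r : R^c) *: m.                       *)

Section Quotient.
Variables (A : zmodType) (S : A -> Prop).

Definition in_zspan (x : A) : Prop :=
  forall H : A -> Prop, H 0 -> (forall y z, H y -> H z -> H (y - z)) ->
    (forall y, S y -> H y) -> H x.

Definition zspan : {pred A} := fun x => `[< in_zspan x >].

Lemma zspan_zmod_closed : zmod_closed zspan.
Proof.
split; first by apply/asboolP => H H0 _ _.
move=> x y /asboolP hx /asboolP hy; apply/asboolP => H H0 HB HS.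
by apply: (HB x y); [exact: hx | exact: hy].
Qed.
HB.instance Definition _ := GRing.isZmodClosed.Build A zspan zspan_zmod_closed.

Lemma zspan_gen x : S x -> x \in zspan.
Proof. by move=> Sx; apply/asboolP => H _ _ HS; apply: HS. Qed.

Definition zquot := Quotient.quot zspan.
HB.instance Definition _ := GRing.Zmodule.on zquot.

Definition zpi (x : A) : zquot := \pi_(Quotient.quot zspan)%qT x.

Lemma zpi_zmod_morphism : zmod_morphism zpi.
Proof. exact: (raddfB \pi_(Quotient.quot zspan)%qT). Qed.
HB.instance Definition _ :=
  GRing.isZmodMorphism.Build A zquot zpi zpi_zmod_morphism.

Lemma zpi_surj (q : zquot) : exists x, zpi x = q.
Proof. by exists (repr (q : Quotient.quot zspan)); rewrite /zpi reprK. Qed.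

Lemma zpi_eq0P x : zpi x = 0 <-> in_zspan x.
Proof.
rewrite -(raddf0 zpi) /zpi; split=> [/eqP|hx].
  by rewrite -Quotient.idealrBE subr0 => /asboolP.
by apply/eqP; rewrite -Quotient.idealrBE subr0; apply/asboolP.
Qed.

Lemma zpi_gen x : S x -> zpi x = 0.
Proof. by move=> Sx; apply/zpi_eq0P/asboolP/zspan_gen. Qed.

Section Lift.
Variables (B : zmodType) (f : {additive A -> B}).
Hypothesis fS : forall x, S x -> f x = 0.

Lemma in_zspan_ker x : in_zspan x -> f x = 0.
Proof.
move/(_ (fun y => f y = 0)); apply=> //; first exact: raddf0.
by move=> y z fy fz; rewrite raddfB fy fz subr0.
Qed.

Definition zlift of (forall x, S x -> f x = 0) : zquot -> B :=
  fun q => f (repr (q : Quotient.quot zspan)).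

Lemma zlift_pi x : zlift fS (zpi x) = f x.
Proof.
apply/eqP; rewrite -subr_eq0 -raddfB; apply/eqP/in_zspan_ker/zpi_eq0P.
by apply/eqP; rewrite raddfB subr_eq0; apply/eqP/reprK.
Qed.

Lemma zlift_zmod_morphism : zmod_morphism (zlift fS).
Proof.
move=> q r; have [x <-] := zpi_surj q; have [y <-] := zpi_surj r.
by rewrite -raddfB !zlift_pi raddfB.
Qed.
HB.instance Definition _ :=
  GRing.isZmodMorphism.Build zquot B (zlift fS) zlift_zmod_morphism.
End Lift.
End Quotient.
Arguments zpi {A} S.
Arguments zlift {A S B} f.

Section FreeLift.
Variables (K : choiceType) (B : zmodType).

Definition free_lift (f : K -> B) : {freeg K} -> B :=
  fglift (f : K -> zmodule B).

Lemma free_lift_zmod_morphism f : zmod_morphism (free_lift f).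
Proof. exact: (@lift_is_additive _ _ (zmodule B) f). Qed.
HB.instance Definition _ f :=
  GRing.isZmodMorphism.Build {freeg K} B (free_lift f) (free_lift_zmod_morphism f).

Lemma free_liftU f k : free_lift f << k >> = f k.
Proof. by rewrite /free_lift liftU scale1r. Qed.

Lemma free_ext (f g : {additive {freeg K} -> B}) :
  (forall k, f << k >> = g << k >>) -> f =1 g.
Proof.
move=> fg x; rewrite -[x]freeg_sumE !raddf_sum; apply: eq_bigr => k _.
by rewrite -[coeff k x]intz -freegU_mulz !raddfMz fg.
Qed.
End FreeLift.

Section Tensor.
Variables (R : pzRingType) (M : lmodType R^c) (N : lmodType R).

Inductive tensor_rel : {freeg (M * N)%type} -> Prop :=
| TensorDl m m' n :
    tensor_rel (<< (m + m', n) >> - << (m, n) >> - << (m', n) >>)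
| TensorDr m n n' :
    tensor_rel (<< (m, n + n') >> - << (m, n) >> - << (m, n') >>)
| TensorZ (r : R) m n :
    tensor_rel (<< ((r : R^c) *: m, n) >> - << (m, r *: n) >>).

Definition tensor := zquot tensor_rel.
HB.instance Definition _ := GRing.Zmodule.on tensor.

Definition tens (m : M) (n : N) : tensor := zpi tensor_rel << (m, n) >>.

Lemma tensDl m m' n : tens (m + m') n = tens m n + tens m' n.
Proof.
apply/eqP; rewrite -subr_eq0 opprD addrA /tens -!(raddfB (zpi _)).
by apply/eqP/zpi_gen/TensorDl.
Qed.

Lemma tensDr m n n' : tens m (n + n') = tens m n + tens m n'.
Proof.
apply/eqP; rewrite -subr_eq0 opprD addrA /tens -!(raddfB (zpi _)).
by apply/eqP/zpi_gen/TensorDr.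
Qed.

Lemma tensZ (r : R) m n : tens ((r : R^c) *: m) n = tens m (r *: n).
Proof.
by apply/eqP; rewrite -subr_eq0 /tens -(raddfB (zpi _)); apply/eqP/zpi_gen/TensorZ.
Qed.

Lemma tens0l n : tens 0 n = 0.
Proof. by apply: (addrI (tens 0 n)); rewrite -tensDl !addr0. Qed.

Lemma tens0r m : tens m 0 = 0.
Proof. by apply: (addrI (tens m 0)); rewrite -tensDr !addr0. Qed.

Lemma tensor_ext (B : zmodType) (f g : {additive tensor -> B}) :
  (forall m n, f (tens m n) = g (tens m n)) -> f =1 g.
Proof.
move=> fg q; have [x <-] := zpi_surj q.
have := @free_ext _ _ (f \o zpi tensor_rel) (g \o zpi tensor_rel).
by apply=> -[m n]; apply: fg.
Qed.
End Tensor.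

Section TensorMap.
Variables (R : pzRingType) (M M' : lmodType R^c) (N N' : lmodType R).
Variables (f : {linear M -> M'}) (g : {linear N -> N'}).

Definition tensor_map_gen (p : M * N) : tensor M' N' := tens (f p.1) (g p.2).

Lemma tensor_map_rel x :
  tensor_rel x -> free_lift tensor_map_gen x = 0.
Proof.
case=> [m m' n|m n n'|r m n]; rewrite !raddfB /= !free_liftU /tensor_map_gen /=.
- by rewrite linearD tensDl -addrA -opprD subrr.
- by rewrite linearD tensDr -addrA -opprD subrr.
- by rewrite !linearZ_LR tensZ subrr.
Qed.

Definition tensor_map : tensor M N -> tensor M' N' :=
  zlift (free_lift tensor_map_gen) tensor_map_rel.
HB.instance Definition _ := GRing.Additive.copy tensor_map
  (zlift (free_lift tensor_map_gen) tensor_map_rel).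

Lemma tensor_mapE m n : tensor_map (tens m n) = tens (f m) (g n).
Proof. exact: etrans (zlift_pi _ _) (free_liftU _ _). Qed.
End TensorMap.

(* Direct sum of a family of abelian groups, presented by the elements (i, a) *)
(* with a in A i, additive in a.                                              *)

Section DirectSum.
Variables (I : choiceType) (A : I -> zmodType).

Inductive dsum_rel : {freeg {i : I & A i}} -> Prop :=
| DsumD i (a b : A i) :
    dsum_rel (<< Tagged A (a + b) >> - << Tagged A a >> - << Tagged A b >>).

Definition dsum := zquot dsum_rel.
HB.instance Definition _ := GRing.Zmodule.on dsum.

Definition dsum_in i (a : A i) : dsum := zpi dsum_rel << Tagged A a >>.

Lemma dsum_in_zmod_morphism i : zmod_morphism (@dsum_in i).
Proof.
move=> a b; rewrite -[X in _ = dsum_in X - _](subrK b a) /dsum_in.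
move: (a - b) => {}a; apply/eqP.
rewrite eq_sym subr_eq -subr_eq0 opprD addrA -!(raddfB (zpi _)).
by apply/eqP/zpi_gen/DsumD.
Qed.
HB.instance Definition _ i :=
  GRing.isZmodMorphism.Build (A i) dsum (@dsum_in i) (@dsum_in_zmod_morphism i).

Lemma dsum_ext (B : zmodType) (f g : {additive dsum -> B}) :
  (forall i (a : A i), f (dsum_in a) = g (dsum_in a)) -> f =1 g.
Proof.
move=> fg q; have [x <-] := zpi_surj q.
have := @free_ext _ _ (f \o zpi dsum_rel) (g \o zpi dsum_rel).
by apply=> -[i a]; apply: fg.
Qed.

Section Lift.
Variables (B : zmodType) (f : forall i, {additive A i -> B}).

Definition dsum_lift_gen (p : {i : I & A i}) : B := f (tag p) (tagged p).

Lemma dsum_lift_rel x : dsum_rel x -> free_lift dsum_lift_gen x = 0.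
Proof.
case=> i a b; rewrite !raddfB /= !free_liftU /dsum_lift_gen /= raddfD.
by rewrite -addrA -opprD subrr.
Qed.

Definition dsum_lift : dsum -> B :=
  zlift (free_lift dsum_lift_gen) dsum_lift_rel.
HB.instance Definition _ := GRing.Additive.copy dsum_lift
  (zlift (free_lift dsum_lift_gen) dsum_lift_rel).

Lemma dsum_lift_in i (a : A i) : dsum_lift (dsum_in a) = f i a.
Proof. exact: etrans (zlift_pi _ _) (free_liftU _ _). Qed.
End Lift.
End DirectSum.
Arguments dsum_in {I A} i.

(* Z-graded, unbounded chain complexes.  The differential lowering the degree *)
(* by one is given as a family indexed by all pairs of degrees (i, j), zero   *)
(* unless i = j + 1, so that no transport along n - 1 + 1 = n is needed.      *)

Record complex (R : pzRingType) := Complex {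
  cobj :> int -> lmodType R;
  cdiff : forall i j, {linear cobj i -> cobj j};
  cdiff_shape : forall i j, i != j + 1 -> forall x, cdiff i j x = 0;
  cdiffK : forall i j k x, cdiff j k (cdiff i j x) = 0
}.
Arguments cdiff {R} c i j.

Record chain_map (R : pzRingType) (X Y : complex R) := ChainMap {
  chain_fun :> forall n, {linear X n -> Y n};
  chain_comm : forall i j x,
    chain_fun j (cdiff X i j x) = cdiff Y i j (chain_fun i x)
}.

Record abcomplex := AbComplex {
  abobj :> int -> zmodType;
  abdiff : forall i j, {additive abobj i -> abobj j};
  abdiff_shape : forall i j, i != j + 1 -> forall x, abdiff i j x = 0;
  abdiffK : forall i j k x, abdiff j k (abdiff i j x) = 0
}.
Arguments abdiff c i j : rename.

Record abchain_map (X Y : abcomplex) := AbChainMap {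
  abchain_fun :> forall n, {additive X n -> Y n};
  abchain_comm : forall i j x,
    abchain_fun j (abdiff X i j x) = abdiff Y i j (abchain_fun i x)
}.

(* The tensor product X (x) Y of complexes: in degree n, the direct sum of    *)
(* X_i (x) Y_j over i + j = n, with d(x (x) y) = dx (x) y + (-1)^i x (x) dy.  *)

Definition bideg (n : int) := {p : int * int | p.1 + p.2 == n}.

Section CTensor.
Variables (R : pzRingType) (X : complex R^c) (Y : complex R).

Definition ct_summand n (p : bideg n) := tensor (X (val p).1) (Y (val p).2).
HB.instance Definition _ n p := GRing.Zmodule.on (@ct_summand n p).

Definition ct_obj (n : int) := dsum (fun p : bideg n => ct_summand p).
HB.instance Definition _ n := GRing.Zmodule.on (ct_obj n).

(* The inclusion of X_i (x) Y_j into degree n, zero by convention when        *)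
(* i + j <> n.                                                                *)
Definition ct_in n i j (z : tensor (X i) (Y j)) : ct_obj n :=
  match boolP (i + j == n) with
  | AltTrue h => dsum_in (exist _ (i, j) h : bideg n) z
  | AltFalse _ => 0
  end.

Lemma ct_in_zmod_morphism n i j : zmod_morphism (@ct_in n i j).
Proof.
rewrite /ct_in => x y; case: {-}_ / boolP => h; last by rewrite subr0.
exact: (raddfB (dsum_in _)).
Qed.
HB.instance Definition _ n i j :=
  GRing.isZmodMorphism.Build (tensor (X i) (Y j)) (ct_obj n) (@ct_in n i j)
    (@ct_in_zmod_morphism n i j).

Lemma ct_inE n (p : bideg n) z : @ct_in n (val p).1 (val p).2 z = dsum_in p z.
Proof.
rewrite /ct_in; case: p z => -[i j] /= h z; case: {-}_ / boolP => h'.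
  by rewrite (bool_irrelevance h' h).
by case/negP: h'.
Qed.

Lemma ct_in_out n i j z : i + j != n -> @ct_in n i j z = 0.
Proof.
by rewrite /ct_in => h; case: {-}_ / boolP => // h'; rewrite h' in h.
Qed.

Lemma ct_ext n (B : zmodType) (f g : {additive ct_obj n -> B}) :
  (forall i j x y, f (@ct_in n i j (tens x y)) = g (@ct_in n i j (tens x y))) ->
  f =1 g.
Proof.
move=> fg; apply: dsum_ext => p z.
pose f' : {additive ct_summand p -> B} := f \o dsum_in p.
pose g' : {additive ct_summand p -> B} := g \o dsum_in p.
by apply: (tensor_ext (f := f') (g := g')) => x y; rewrite /= -!ct_inE fg.
Qed.

Definition ct_dl_fun n m (p : bideg n) (z : ct_summand p) : ct_obj m :=
  ct_in m (tensor_map (cdiff X (val p).1 ((val p).1 - 1)) idfun z).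

Definition ct_dr_fun n m (p : bideg n) (z : ct_summand p) : ct_obj m :=
  ct_in m (tensor_map idfun (cdiff Y (val p).2 ((val p).2 - 1)) z)
    *~ (-1) ^+ `|(val p).1|.

Lemma ct_dl_fun_zmod_morphism n m p : zmod_morphism (@ct_dl_fun n m p).
Proof. by move=> x y; rewrite /ct_dl_fun !raddfB. Qed.
HB.instance Definition _ n m p :=
  GRing.isZmodMorphism.Build (ct_summand p) (ct_obj m) (@ct_dl_fun n m p)
    (@ct_dl_fun_zmod_morphism n m p).

Lemma ct_dr_fun_zmod_morphism n m p : zmod_morphism (@ct_dr_fun n m p).
Proof. by move=> x y; rewrite /ct_dr_fun !raddfB mulrzBl. Qed.
HB.instance Definition _ n m p :=
  GRing.isZmodMorphism.Build (ct_summand p) (ct_obj m) (@ct_dr_fun n m p)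
    (@ct_dr_fun_zmod_morphism n m p).

Definition ct_dl n m : ct_obj n -> ct_obj m :=
  dsum_lift (fun p => @ct_dl_fun n m p).
Arguments ct_dl n m z : clear implicits.
HB.instance Definition _ n m := GRing.Additive.copy (ct_dl n m)
  (dsum_lift (fun p => @ct_dl_fun n m p)).

Definition ct_dr n m : ct_obj n -> ct_obj m :=
  dsum_lift (fun p => @ct_dr_fun n m p).
Arguments ct_dr n m z : clear implicits.
HB.instance Definition _ n m := GRing.Additive.copy (ct_dr n m)
  (dsum_lift (fun p => @ct_dr_fun n m p)).

Definition ct_diff n m : ct_obj n -> ct_obj m := ct_dl n m \+ ct_dr n m.
Arguments ct_diff n m z : clear implicits.
HB.instance Definition _ n m := GRing.Additive.copy (ct_diff n m)
  (ct_dl n m \+ ct_dr n m).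

Lemma ct_dlE m i j x y :
  ct_dl (m + 1) m (@ct_in (m + 1) i j (tens x y)) =
  @ct_in m (i - 1) j (tens (cdiff X i (i - 1) x) y).
Proof.
have [h|h] := boolP (i + j == m + 1); last first.
  rewrite !ct_in_out ?raddf0 //; apply: contra h => /eqP <-.
  by rewrite addrAC subrK.
have := @ct_inE _ (exist _ (i, j) h : bideg (m + 1)) (tens x y) => /= ->.
rewrite [LHS]dsum_lift_in /= /ct_dl_fun /=.
by rewrite tensor_mapE.
Qed.

Lemma ct_drE m i j x y :
  ct_dr (m + 1) m (@ct_in (m + 1) i j (tens x y)) =
  @ct_in m i (j - 1) (tens x (cdiff Y j (j - 1) y)) *~ (-1) ^+ `|i|.
Proof.
have [h|h] := boolP (i + j == m + 1); last first.
  rewrite !ct_in_out ?raddf0 ?mul0rz //; apply: contra h => /eqP <-.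
  by rewrite addrA subrK.
have := @ct_inE _ (exist _ (i, j) h : bideg (m + 1)) (tens x y) => /= ->.
rewrite [LHS]dsum_lift_in /= /ct_dr_fun /=.
by rewrite tensor_mapE.
Qed.

Lemma ct_dl_shape n m : n != m + 1 -> forall z, ct_dl n m z = 0.
Proof.
move=> nm z; rewrite -[RHS]/((\0 : {additive ct_obj n -> ct_obj m}) z).
apply: dsum_ext z => p z; rewrite [LHS]dsum_lift_in /= /ct_dl_fun /=.
rewrite ct_in_out //; apply: contra nm => /eqP <-.
by rewrite addrAC subrK (eqP (valP p)).
Qed.

Lemma ct_dr_shape n m : n != m + 1 -> forall z, ct_dr n m z = 0.
Proof.
move=> nm z; rewrite -[RHS]/((\0 : {additive ct_obj n -> ct_obj m}) z).
apply: dsum_ext z => p z; rewrite [LHS]dsum_lift_in /= /ct_dr_fun /=.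
rewrite ct_in_out ?mul0rz //; apply: contra nm => /eqP <-.
by rewrite addrA subrK (eqP (valP p)).
Qed.

Lemma ct_diff_shape n m : n != m + 1 -> forall z, ct_diff n m z = 0.
Proof.
by move=> nm z; rewrite /ct_diff /= ct_dl_shape // ct_dr_shape // addr0.
Qed.

Lemma sgn_pred (i : int) : (-1) ^+ `|i - 1| = - (-1) ^+ `|i| :> int.
Proof.
case: i => [[|n]|n] //; rewrite ?NegzE.
  have -> : n.+1%:Z - 1 = n by rewrite -addn1 PoszD addrK.
  by rewrite exprS mulN1r opprK.
by rewrite -opprD -PoszD addn1 !abszN [in LHS]exprS mulN1r.
Qed.

Lemma ct_dlK n m k z : ct_dl m k (ct_dl n m z) = 0.
Proof.
have [->|h] := eqVneq m (k + 1); last exact: ct_dl_shape.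
have [nE|h] := eqVneq n (k + 1 + 1); last by rewrite (ct_dl_shape h) raddf0.
subst n; rewrite -[RHS]/((\0 : {additive _ -> ct_obj k}) z).
rewrite -[LHS]/((ct_dl _ k \o ct_dl _ (k + 1) : {additive _ -> _}) z).
apply: ct_ext z => i j x y /=.
by rewrite !ct_dlE cdiffK tens0l raddf0.
Qed.

Lemma ct_drK n m k z : ct_dr m k (ct_dr n m z) = 0.
Proof.
have [->|h] := eqVneq m (k + 1); last exact: ct_dr_shape.
have [nE|h] := eqVneq n (k + 1 + 1); last by rewrite (ct_dr_shape h) raddf0.
subst n; rewrite -[RHS]/((\0 : {additive _ -> ct_obj k}) z).
rewrite -[LHS]/((ct_dr _ k \o ct_dr _ (k + 1) : {additive _ -> _}) z).
apply: ct_ext z => i j x y /=.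
by rewrite ct_drE raddfMz /= ct_drE cdiffK tens0r raddf0 !mul0rz.
Qed.

Lemma ct_dlr n m k z : ct_dl m k (ct_dr n m z) = - ct_dr m k (ct_dl n m z).
Proof.
have [->|h] := eqVneq m (k + 1); last first.
  by rewrite (ct_dl_shape h) (ct_dr_shape h) oppr0.
have [nE|h] := eqVneq n (k + 1 + 1); last first.
  by rewrite (ct_dr_shape h) (ct_dl_shape h) !raddf0.
subst n.
rewrite -[RHS]/((-%R \o (ct_dr _ k \o ct_dl _ (k + 1)) : {additive _ -> _}) z).
rewrite -[LHS]/((ct_dl _ k \o ct_dr _ (k + 1) : {additive _ -> _}) z).
apply: ct_ext z => i j x y /=.
by rewrite ct_drE raddfMz /= !ct_dlE ct_drE sgn_pred mulrNz opprK.
Qed.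

Lemma ct_diffK n m k z : ct_diff m k (ct_diff n m z) = 0.
Proof.
rewrite /ct_diff /= [ct_dl m k _]raddfD [ct_dr m k _]raddfD /=.
by rewrite ct_dlK ct_drK add0r addr0 ct_dlr addNr.
Qed.

Definition ctensor : abcomplex :=
  @AbComplex ct_obj (fun n m => ct_diff n m) ct_diff_shape ct_diffK.

Inductive ct_boundary n : ctensor n -> Prop :=
| CtBoundary w : ct_boundary (abdiff ctensor (n + 1) n w).

Definition bt_obj (n : int) := zquot (@ct_boundary n).
HB.instance Definition _ n := GRing.Zmodule.on (bt_obj n).

Lemma bt_diff_rel n m z :
  ct_boundary z -> (zpi (@ct_boundary m) \o ct_dl n m) z = 0.
Proof.
case=> w /=; have [nE|h] := eqVneq n (m + 1); last by rewrite ct_dl_shape ?raddf0.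
subst n; rewrite /ct_diff /= [ct_dl _ m _]raddfD /= ct_dlK add0r ct_dlr raddfN.
apply/eqP; rewrite oppr_eq0; apply/eqP/zpi_gen.
have <- : ct_diff (m + 1) m (ct_dl (m + 1 + 1) (m + 1) w) =
  ct_dr (m + 1) m (ct_dl (m + 1 + 1) (m + 1) w).
  by rewrite /ct_diff /= ct_dlK add0r.
exact: CtBoundary.
Qed.

(* ct_dl is the part dx (x) y of the differential of X (x) Y.                 *)
Definition bt_diff n m : bt_obj n -> bt_obj m :=
  zlift (zpi (@ct_boundary m) \o ct_dl n m) (@bt_diff_rel n m).
Arguments bt_diff n m q : clear implicits.
HB.instance Definition _ n m := GRing.Additive.copy (bt_diff n m)
  (zlift (zpi (@ct_boundary m) \o ct_dl n m) (@bt_diff_rel n m)).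

Lemma bt_diffE n m z :
  bt_diff n m (zpi (@ct_boundary n) z) = zpi (@ct_boundary m) (ct_dl n m z).
Proof. exact: zlift_pi. Qed.

Lemma bt_diff_shape n m : n != m + 1 -> forall q, bt_diff n m q = 0.
Proof.
move=> nm q; have [z <-] := zpi_surj q.
by rewrite bt_diffE ct_dl_shape ?raddf0.
Qed.

Lemma bt_diffK n m k q : bt_diff m k (bt_diff n m q) = 0.
Proof.
by have [z <-] := zpi_surj q; rewrite !bt_diffE ct_dlK raddf0.
Qed.

Definition bartensor : abcomplex :=
  @AbComplex bt_obj (fun n m => bt_diff n m) bt_diff_shape bt_diffK.

End CTensor.
Arguments ct_dl {R} X Y n m z.
Arguments ct_dr {R} X Y n m z.
Arguments ct_diff {R} X Y n m z.
Arguments bt_diff {R} X Y n m q.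
Arguments ct_boundary {R} X Y n.

Section CTensorMap.
Variables (R : pzRingType) (X X' : complex R^c) (f : chain_map X X').
Variable Y : complex R.

Definition ct_map_fun n (p : bideg n) (z : ct_summand X Y p) :
    ct_summand X' Y p :=
  tensor_map (f (val p).1) idfun z.
Lemma ct_map_fun_zmod_morphism n p : zmod_morphism (@ct_map_fun n p).
Proof. exact: raddfB. Qed.
HB.instance Definition _ n p :=
  GRing.isZmodMorphism.Build (ct_summand X Y p) (ct_summand X' Y p)
    (@ct_map_fun n p) (@ct_map_fun_zmod_morphism n p).

Definition ct_map n : ct_obj X Y n -> ct_obj X' Y n :=
  dsum_lift (fun p => dsum_in p \o @ct_map_fun n p).
HB.instance Definition _ n := GRing.Additive.copy (@ct_map n)
  (dsum_lift (fun p => dsum_in p \o @ct_map_fun n p)).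

Lemma ct_mapE n i j x y :
  ct_map (ct_in n (tens x y : tensor (X i) (Y j))) = ct_in n (tens (f i x) y).
Proof.
have [h|h] := boolP (i + j == n); last by rewrite !ct_in_out ?raddf0.
have := @ct_inE _ X Y _ (exist _ (i, j) h : bideg n) (tens x y) => /= ->.
rewrite [LHS]dsum_lift_in /= /ct_map_fun /= tensor_mapE.
by rewrite -ct_inE.
Qed.

Lemma ct_map_dl n m z : ct_map (ct_dl X Y n m z) = ct_dl X' Y n m (ct_map z).
Proof.
have [nE|h] := eqVneq n (m + 1); last by rewrite !ct_dl_shape ?raddf0.
subst n.
rewrite -[RHS]/((ct_dl X' Y _ m \o @ct_map (m + 1) : {additive _ -> _}) z).
rewrite -[LHS]/((@ct_map m \o ct_dl X Y (m + 1) m : {additive _ -> _}) z).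
apply: ct_ext z => i j x y /=.
by rewrite ct_dlE !ct_mapE ct_dlE chain_comm.
Qed.

Lemma ct_map_dr n m z : ct_map (ct_dr X Y n m z) = ct_dr X' Y n m (ct_map z).
Proof.
have [nE|h] := eqVneq n (m + 1); last by rewrite !ct_dr_shape ?raddf0.
subst n.
rewrite -[RHS]/((ct_dr X' Y _ m \o @ct_map (m + 1) : {additive _ -> _}) z).
rewrite -[LHS]/((@ct_map m \o ct_dr X Y (m + 1) m : {additive _ -> _}) z).
apply: ct_ext z => i j x y /=.
by rewrite ct_drE raddfMz /= !ct_mapE ct_drE.
Qed.

Lemma ct_map_comm n m z :
  ct_map (abdiff (ctensor X Y) n m z) = abdiff (ctensor X' Y) n m (ct_map z).
Proof. by rewrite /= /ct_diff /= raddfD /= ct_map_dl ct_map_dr. Qed.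

Definition ctensor_map : abchain_map (ctensor X Y) (ctensor X' Y) :=
  @AbChainMap (ctensor X Y) (ctensor X' Y) (fun n => @ct_map n) ct_map_comm.

Lemma bt_map_rel n z : ct_boundary X Y n z ->
  (zpi (ct_boundary X' Y n) \o @ct_map n) z = 0.
Proof. by case=> w; rewrite /= ct_map_comm; apply/zpi_gen/CtBoundary. Qed.

Definition bt_map n : bt_obj X Y n -> bt_obj X' Y n :=
  zlift (zpi (ct_boundary X' Y n) \o @ct_map n) (@bt_map_rel n).
HB.instance Definition _ n := GRing.Additive.copy (@bt_map n)
  (zlift (zpi (ct_boundary X' Y n) \o @ct_map n) (@bt_map_rel n)).

Lemma bt_mapE n z :
  bt_map (zpi (ct_boundary X Y n) z) = zpi (ct_boundary X' Y n) (ct_map z).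
Proof. exact: zlift_pi. Qed.

Lemma bt_map_comm n m q :
  bt_map (abdiff (bartensor X Y) n m q) =
  abdiff (bartensor X' Y) n m (bt_map q).
Proof.
have [z <-] := zpi_surj q.
by rewrite /= bt_diffE !bt_mapE bt_diffE ct_map_dl.
Qed.

Definition bartensor_map : abchain_map (bartensor X Y) (bartensor X' Y) :=
  @AbChainMap (bartensor X Y) (bartensor X' Y) (fun n => @bt_map n) bt_map_comm.
End CTensorMap.

Definition surjection (A B : Type) (f : A -> B) := forall b, exists a, f a = b.

Definition fin_gen (R : pzRingType) (M : lmodType R) : Prop :=
  exists (n : nat) (g : 'I_n -> M),
    forall x, exists c : 'I_n -> R, x = \sum_(i < n) c i *: g i.

Definition projective (R : pzRingType) (P : lmodType R) : Prop :=
  forall (A B : lmodType R) (g : {linear A -> B}) (f : {linear P -> B}),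
    surjection g -> exists h : {linear P -> A}, forall x, g (h x) = f x.

Record resolution (R : pzRingType) (M : lmodType R) := Resolution {
  res_obj :> nat -> lmodType R;
  res_diff : forall k, {linear res_obj k.+1 -> res_obj k};
  res_aug : {linear res_obj 0%N -> M};
  res_proj : forall k, projective (res_obj k);
  res_aug_surj : surjection res_aug;
  res_exact0 : forall x, res_aug x = 0 <-> exists y, res_diff 0 y = x;
  res_exact : forall k x,
    res_diff k x = 0 <-> exists y, res_diff k.+1 y = x
}.
Arguments res_diff {R M} r k.

Definition FP_infty (R : pzRingType) (M : lmodType R) : Prop :=
  exists P : resolution M, forall k, fin_gen (P k).

(* Tor_1(M, N) = H_1(P (x) N) for a projective resolution P of M.  The value  *)
(* does not depend on P, so its vanishing is stated for every P; level_module *)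
(* only uses it for M of type FP_oo, for which some P exists by definition.   *)
Definition Tor1_eq0 (R : pzRingType) (M : lmodType R^c) (N : lmodType R) : Prop :=
  forall (P : resolution M) (z : tensor (P 1%N) N),
    tensor_map (res_diff P 0) idfun z = 0 ->
    exists w : tensor (P 2%N) N, tensor_map (res_diff P 1) idfun w = z.

Definition level_module (R : pzRingType) (N : lmodType R) : Prop :=
  forall M : lmodType R^c, FP_infty M -> Tor1_eq0 M N.

(* Epimorphisms and exact sequences in the category of complexes are the      *)
(* degreewise ones.                                                           *)

Definition chain_surjection (R : pzRingType) (X Y : complex R)
    (f : chain_map X Y) : Prop := forall n, surjection (f n).

Definition fin_gen_complex (R : pzRingType) (X : complex R) : Prop :=
  (exists a b : int, forall n, ~~ (a <= n <= b) -> forall x : X n, x = 0) /\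
  (forall n, fin_gen (X n)).

Definition projective_complex (R : pzRingType) (P : complex R) : Prop :=
  forall (A B : complex R) (g : chain_map A B) (f : chain_map P B),
    chain_surjection g ->
    exists h : chain_map P A, forall n x, g n (h n x) = f n x.

Record complex_resolution (R : pzRingType) (X : complex R) := ComplexResolution {
  cres_obj :> nat -> complex R;
  cres_diff : forall k, chain_map (cres_obj k.+1) (cres_obj k);
  cres_aug : chain_map (cres_obj 0%N) X;
  cres_proj : forall k, projective_complex (cres_obj k);
  cres_aug_surj : chain_surjection cres_aug;
  cres_exact0 : forall n x,
    cres_aug n x = 0 <-> exists y, cres_diff 0 n y = x;
  cres_exact : forall k n x,
    cres_diff k n x = 0 <-> exists y, cres_diff k.+1 n y = x
}.
Arguments cres_diff {R X} c k.

Definition FP_infty_complex (R : pzRingType) (X : complex R) : Prop :=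
  exists P : complex_resolution X, forall k, fin_gen_complex (P k).

(* The first left derived functor of - bartensor L vanishes at X, computed as *)
(* H_1 of P bartensor L; see the remark on Tor1_eq0 about the resolution P.   *)
Definition barTor1_eq0 (R : pzRingType) (X : complex R^c) (L : complex R) : Prop :=
  forall (P : complex_resolution X) (n : int) (z : bartensor (P 1%N) L n),
    bartensor_map (cres_diff P 0) L n z = 0 ->
    exists w : bartensor (P 2%N) L n, bartensor_map (cres_diff P 1) L n w = z.

Definition level_complex (R : pzRingType) (L : complex R) : Prop :=
  forall X : complex R^c, FP_infty_complex X -> barTor1_eq0 X L.

Definition exact_complex (R : pzRingType) (L : complex R) : Prop :=
  forall n (x : L n), cdiff L n (n - 1) x = 0 ->
    exists y : L (n + 1), cdiff L (n + 1) n y = x.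

Section Kernel.
Variables (R : pzRingType) (U V : lmodType R) (f : {linear U -> V}).

Definition kerp : {pred U} := fun x => f x == 0.

Lemma kerp_submod_closed : submod_closed kerp.
Proof.
split=> [|a x y /eqP fx /eqP fy]; apply/eqP; first exact: raddf0.
by rewrite linearP fx fy scaler0 addr0.
Qed.
HB.instance Definition _ :=
  GRing.isSubmodClosed.Build R U kerp kerp_submod_closed.

Record ker_of := KerOf { ker_val : U; _ : ker_val \in kerp }.
HB.instance Definition _ := [isSub for ker_val].
HB.instance Definition _ := [Choice of ker_of by <:].
HB.instance Definition _ := [SubChoice_isSubLmodule of ker_of by <:].
End Kernel.

Definition cycle_module (R : pzRingType) (L : complex R) (n : int) : lmodType R :=
  ker_of (cdiff L n (n - 1)).

(* Main.v *)
From HB Require Import structures.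
Require Import Defs.
From mathcomp Require Import all_boot all_order all_algebra.
From mathcomp Require Import boolp.
From mathcomp Require Import freeg.
From mathcomp Require Import zify.

(* For a projective cover P -> M with kernel K, Tor_1(M, N) = 0 means that     *)
(* K (x) N -> P (x) N is injective, and likewise for complexes and the         *)
(* modified tensor product; for complexes this injectivity does not depend on  *)
(* the cover.                                                                  *)
(* If L is level, test it on M placed in degree 0, which is FP_oo when M is,   *)
(* with the cover by the disc on P.  For M = R this gives exactness of L, and  *)
(* then for general M the injectivity of K (x) Z_n L -> P (x) Z_n L.           *)
(* Conversely, let X be FP_oo, with cover P and kernel K.  Then X is bounded   *)
(* with FP_oo components, so the rows X_i (x) L are exact, hence so is         *)
(* X (x) L; moreover 0 -> K (x) L -> P (x) L -> X (x) L -> 0 is exact.  So an  *)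
(* element of K (x) L that bounds in P (x) L already bounds in K (x) L.        *)

Set Implicit Arguments.
Unset Strict Implicit.
Unset Printing Implicit Defensive.

Import GRing.Theory.
Local Open Scope ring_scope.

(** Both vanishing conditions become injectivity statements: [Tor1_inj] and [barTor1_inj] replace a
    resolution by its cover P -> X with kernel K, and [bar_flat_kernel_indep] lets the cover be
    chosen freely on the complex side. For a level complex L the chosen cover is the disc on P
    mapping onto the sphere on M ([level_sphere_cover]). Its kernel is ker f in degree 0 and P in
    degree -1. In the disc, the copy of P in degree -1 is the differential of the copy in degree 0,
    so suitable classes die in the modified tensor product with the disc, hence already in the one
    with the kernel. Additive maps that kill boundaries then extract the conclusion:
    [level_complex_exact] for M = R, [level_complex_cycle] for general M. In the other direction,
    exactness of L gives short exact sequences 0 -> Z_(n+1) -> L_(n+1) -> Z_n -> 0. Since Tor_1(X_i,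
    Z_n) = 0, the rows X_i (x) L are exact ([tensor_row_exact]) and K_i (x) L_n -> P_i (x) L_n is
    injective ([ker_aug_mono]). Boundedness of X makes X (x) L exact ([ctensor_exact]), and
    [level_complex_of_cycles] is the resulting diagram chase. *)

Definition mk_linear (R : pzRingType) (U V : lmodType R) (f : U -> V)
    (H : linear f) : {linear U -> V} :=
  HB.pack f (GRing.isLinear.Build R U V *:%R f H).

Arguments mk_linear {R U V f} H : simpl never.

Lemma in_zspan_closed (A : zmodType) (S H : A -> Prop) :
  H 0 -> (forall y z, H y -> H z -> H (y - z)) ->
  (forall y, S y -> H y) -> forall z, in_zspan S z -> H z.
Proof. by move=> H0 HB HS z; apply. Qed.

(** * Right exactness of the tensor product *)

Section TensorTheory.
Variables (R : pzRingType).
Implicit Types (M : lmodType R^c) (N : lmodType R).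

(** The projection modulo the subgroup generated by [H] is additive and kills pure tensors, so it is
    zero by [tensor_ext]; as [H] is closed under subtraction, that subgroup is [H] itself. *)
Lemma tensor_ind M N (H : tensor M N -> Prop) :
  H 0 -> (forall y z, H y -> H z -> H (y - z)) ->
  (forall m n, H (tens m n)) -> forall z, H z.
Proof.
move=> H0 HB Ht z.
have /zpi_eq0P : zpi H z = 0; last by move/(_ H H0 HB); apply.
rewrite -[RHS]/((\0 : {additive _ -> _}) z).
by apply: tensor_ext => m n; apply/zpi_gen.
Qed.

Section Lift.
Variables (M : lmodType R^c) (N : lmodType R) (B : zmodType) (b : M -> N -> B).
Hypothesis bDl : forall m m' n, b (m + m') n = b m n + b m' n.
Hypothesis bDr : forall m n n', b m (n + n') = b m n + b m n'.
Hypothesis bZ : forall (r : R) m n, b ((r : R^c) *: m) n = b m (r *: n).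

Lemma tensor_lift_rel x :
  tensor_rel x -> free_lift (fun p : M * N => b p.1 p.2) x = 0.
Proof.
case=> [m m' n|m n n'|r m n]; rewrite !raddfB /= !free_liftU /=.
- by rewrite bDl -addrA -opprD subrr.
- by rewrite bDr -addrA -opprD subrr.
- by rewrite bZ subrr.
Qed.

Definition tensor_lift : tensor M N -> B :=
  zlift (free_lift (fun p : M * N => b p.1 p.2)) tensor_lift_rel.
HB.instance Definition _ := GRing.Additive.copy tensor_lift
  (zlift (free_lift (fun p : M * N => b p.1 p.2)) tensor_lift_rel).

Lemma tensor_liftE m n : tensor_lift (tens m n) = b m n.
Proof. exact: etrans (zlift_pi _ _) (free_liftU _ _). Qed.
End Lift.

Lemma tens_opprl M N (m : M) (n : N) : tens (- m) n = - tens m n.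
Proof. by apply/eqP; rewrite -subr_eq0 opprK -tensDl addNr tens0l. Qed.

Lemma tens_opprr M N (m : M) (n : N) : tens m (- n) = - tens m n.
Proof. by apply/eqP; rewrite -subr_eq0 opprK -tensDr addNr tens0r. Qed.

Lemma tensBl M N (m m' : M) (n : N) : tens (m - m') n = tens m n - tens m' n.
Proof. by rewrite tensDl tens_opprl. Qed.

Lemma tensBr M N (m : M) (n n' : N) : tens m (n - n') = tens m n - tens m n'.
Proof. by rewrite tensDr tens_opprr. Qed.

Lemma tensor_map_comp M M' M'' N N' N''
    (f : {linear M -> M'}) (f' : {linear M' -> M''}) (f'' : {linear M -> M''})
    (g : {linear N -> N'}) (g' : {linear N' -> N''}) (g'' : {linear N -> N''}) :
  (forall x, f' (f x) = f'' x) -> (forall y, g' (g y) = g'' y) ->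
  forall z, tensor_map f' g' (tensor_map f g z) = tensor_map f'' g'' z.
Proof.
move=> ff gg z.
rewrite -[LHS]/((tensor_map f' g' \o tensor_map f g : {additive _ -> _}) z).
by apply: tensor_ext z => m n; rewrite /= !tensor_mapE ff gg.
Qed.

Lemma tensor_map_comm M M1 M2 M' N N1 N2 N'
    (f1 : {linear M -> M1}) (f1' : {linear M1 -> M'})
    (f2 : {linear M -> M2}) (f2' : {linear M2 -> M'})
    (g1 : {linear N -> N1}) (g1' : {linear N1 -> N'})
    (g2 : {linear N -> N2}) (g2' : {linear N2 -> N'}) :
  (forall x, f1' (f1 x) = f2' (f2 x)) -> (forall y, g1' (g1 y) = g2' (g2 y)) ->
  forall z, tensor_map f1' g1' (tensor_map f1 g1 z) =
            tensor_map f2' g2' (tensor_map f2 g2 z).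
Proof.
move=> ff gg z.
by rewrite (tensor_map_comp (f'' := f2' \o f2) (g'' := g2' \o g2) ff gg)
           (tensor_map_comp (f'' := f2' \o f2) (g'' := g2' \o g2)).
Qed.

Lemma tensor_map_id M N (f : {linear M -> M}) (g : {linear N -> N}) :
  (forall x, f x = x) -> (forall y, g y = y) -> forall z, tensor_map f g z = z.
Proof.
move=> fx gy z; rewrite -[RHS]/((idfun : {additive _ -> _}) z).
by apply: tensor_ext z => m n; rewrite /= tensor_mapE fx gy.
Qed.

Lemma tensor_map0 M M' N N' (f : {linear M -> M'}) (g : {linear N -> N'}) :
  (forall x y, tens (f x) (g y) = 0) -> forall z, tensor_map f g z = 0.
Proof.
move=> fg z; rewrite -[RHS]/((\0 : {additive _ -> _}) z).
by apply: tensor_ext z => m n; rewrite /= tensor_mapE fg.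
Qed.

Lemma tensor_map_surj M M' N N' (f : {linear M -> M'}) (g : {linear N -> N'}) :
  surjection f -> surjection g -> surjection (tensor_map f g).
Proof.
move=> fs gs; apply: tensor_ind => [|y z [u <-] [v <-]|m n].
- by exists 0; rewrite raddf0.
- by exists (u - v); rewrite raddfB.
- by have [x <-] := fs m; have [y <-] := gs n; exists (tens x y); rewrite tensor_mapE.
Qed.

Lemma tensor_trivl M N : (forall x : M, x = 0) -> forall z : tensor M N, z = 0.
Proof.
move=> M0; apply: tensor_ind => [//|y z -> ->|m n]; first by rewrite subr0.
by rewrite (M0 m) tens0l.
Qed.

(* The inverse of (M (x) N) / S -> M' (x) N' sends f m (x) g n to the class of *)
(* m (x) n.                                                                    *)
Lemma tensor_map_ker M M' N N' (f : {linear M -> M'}) (g : {linear N -> N'}) z :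
  surjection f -> surjection g -> tensor_map f g z = 0 ->
  in_zspan (fun t => exists m n, t = tens m n /\ (f m = 0 \/ g n = 0)) z.
Proof.
move=> /choice[s sK] /choice[t tK]; set S := (fun _ => _) => fgz.
have key m1 m2 n1 n2 : f m1 = f m2 -> g n1 = g n2 ->
    zpi S (tens m1 n1) = zpi S (tens m2 n2).
  move=> fm gn; apply/eqP; rewrite -subr_eq0.
  have -> : zpi S (tens m1 n1) - zpi S (tens m2 n2) =
      zpi S (tens (m1 - m2) n1) + zpi S (tens m2 (n1 - n2)).
    by rewrite -raddfB -raddfD tensBl tensBr addrA subrK.
  rewrite !zpi_gen ?addr0 //.
    by exists m2, (n1 - n2); split=> //; right; rewrite linearB /= gn subrr.
  by exists (m1 - m2), n1; split=> //; left; rewrite linearB /= fm subrr.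
pose b m' n' := zpi S (tens (s m') (t n')).
have bDl m m' n : b (m + m') n = b m n + b m' n.
  by rewrite -raddfD -tensDl; apply: key; rewrite // linearD /= !sK.
have bDr m n n' : b m (n + n') = b m n + b m n'.
  by rewrite -raddfD -tensDr; apply: key; rewrite // linearD /= !tK.
have bZ (r : R) m n : b ((r : R^c) *: m) n = b m (r *: n).
  transitivity (zpi S (tens ((r : R^c) *: s m) (t n))).
    by apply: key; rewrite // linearZ_LR /= !sK.
  by rewrite tensZ; apply: key; rewrite // linearZ_LR /= !tK.
apply/zpi_eq0P.
pose h : {additive tensor M N -> _} := tensor_lift bDl bDr bZ \o tensor_map f g.
have -> : zpi S z = h z.
  clear fgz; move: z; apply: tensor_ext => m n; rewrite /h /= tensor_mapE tensor_liftE.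
  by apply: key; rewrite ?sK ?tK.
by rewrite /h /= fgz raddf0.
Qed.

Lemma tensor_rexact_l (K : lmodType R^c) M M' N (k : {linear K -> M})
    (f : {linear M -> M'}) z :
  surjection f -> (forall x, f x = 0 -> exists y, k y = x) ->
  tensor_map f (idfun : {linear N -> N}) z = 0 ->
  exists w, tensor_map k idfun w = z.
Proof.
move=> fs kf fz; have ids : surjection (idfun : N -> N) by move=> y; exists y.
have := tensor_map_ker fs ids fz.
apply: (in_zspan_closed (H := fun z => exists w, _ = z)).
- by exists 0; rewrite raddf0.
- by move=> ? ? [u <-] [v <-]; exists (u - v); rewrite raddfB.
- move=> _ [m [n [-> [/kf[y <-]|/= ->]]]]; last by exists 0; rewrite raddf0 tens0r.
  by exists (tens y n); rewrite tensor_mapE.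
Qed.

Lemma tensor_rexact_r M (K : lmodType R) N N' (k : {linear K -> N})
    (g : {linear N -> N'}) z :
  surjection g -> (forall x, g x = 0 -> exists y, k y = x) ->
  tensor_map (idfun : {linear M -> M}) g z = 0 ->
  exists w, tensor_map idfun k w = z.
Proof.
move=> gs kg gz; have ids : surjection (idfun : M -> M) by move=> y; exists y.
have := tensor_map_ker ids gs gz.
apply: (in_zspan_closed (H := fun z => exists w, _ = z)).
- by exists 0; rewrite raddf0.
- by move=> ? ? [u <-] [v <-]; exists (u - v); rewrite raddfB.
- move=> _ [m [n [-> [/= ->|/kg[y <-]]]]]; first by exists 0; rewrite raddf0 tens0l.
  by exists (tens m y); rewrite tensor_mapE.
Qed.
End TensorTheory.

(** * Components of the tensor product of complexes *)

Section Transport.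
Variables (R : pzRingType) (F : int -> lmodType R).

(* Transport along i = j; it is zero when i <> j, so that no proof of i = j    *)
(* has to be carried around.                                                   *)
Definition tr i j (x : F i) : F j :=
  match @eqP _ i j with
  | ReflectT e => ecast k (F k) e x
  | ReflectF _ => 0
  end.

Lemma tr_linear i j : linear (@tr i j).
Proof.
rewrite /tr => a x y; case: eqP => e; last by rewrite scaler0 addr0.
by case: _ / e.
Qed.
HB.instance Definition _ i j :=
  GRing.isLinear.Build R (F i) (F j) *:%R (@tr i j) (@tr_linear i j).

Lemma tr_id i x : @tr i i x = x.
Proof. by rewrite /tr; case: eqP => // e; rewrite (eq_axiomK e). Qed.

Lemma tr_neq i j x : i != j -> @tr i j x = 0.
Proof. by rewrite /tr; case: eqP. Qed.
End Transport.

Lemma tr_natural (R : pzRingType) (F G : int -> lmodType R)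
    (f : forall i, {linear F i -> G i}) i j x :
  tr j (f i x) = f j (tr j x).
Proof.
have [<-|h] := eqVneq i j; first by rewrite !tr_id.
by rewrite !tr_neq // raddf0.
Qed.

Lemma tr_cdiff (R : pzRingType) (X : complex R) i j x :
  tr j (cdiff X i (i - 1) x) = cdiff X (j + 1) j (tr (j + 1) x).
Proof.
have [e|h] := eqVneq (i - 1) j.
  by subst j; rewrite tr_id subrK tr_id.
rewrite !tr_neq ?raddf0 //; apply: contra h => /eqP ->.
by rewrite addrK.
Qed.

Section TensorComplex.
Variables (R : pzRingType) (X : complex R^c) (Y : complex R).

Lemma ct_ind n (H : ct_obj X Y n -> Prop) :
  H 0 -> (forall y z, H y -> H z -> H (y - z)) ->
  (forall i j (x : X i) (y : Y j), i + j = n -> H (ct_in n (tens x y))) ->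
  forall z, H z.
Proof.
move=> H0 Hsub Ht z.
have /zpi_eq0P : zpi H z = 0; last by move/(_ H H0 Hsub); apply.
rewrite -[RHS]/((\0 : {additive _ -> _}) z); move: z.
apply: (ct_ext (f := zpi H)) => i j x y; apply/zpi_gen.
have [/eqP h|h] := boolP (i + j == n); first exact: Ht.
by rewrite ct_in_out.
Qed.

(** The coordinate of bidegree (i, j). Since [tr] vanishes between distinct degrees, every other
    summand is sent to 0 and no equality of degrees has to be supplied. *)
Definition ct_proj n i j : ct_obj X Y n -> tensor (X i) (Y j) :=
  dsum_lift (fun p : bideg n =>
    tensor_map (@tr _ X (val p).1 i) (@tr _ Y (val p).2 j)
      : {additive ct_summand X Y p -> tensor (X i) (Y j)}).
HB.instance Definition _ n i j := GRing.Additive.copy (@ct_proj n i j)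
  (dsum_lift (fun p : bideg n =>
    tensor_map (@tr _ X (val p).1 i) (@tr _ Y (val p).2 j)
      : {additive ct_summand X Y p -> tensor (X i) (Y j)})).

Lemma ct_projE n i j i' j' (z : tensor (X i') (Y j')) : i + j = n ->
  ct_proj i j (ct_in n z) = tensor_map (@tr _ X i' i) (@tr _ Y j' j) z.
Proof.
move=> ijn; have [h|h] := boolP (i' + j' == n).
  have := @ct_inE _ X Y _ (exist _ (i', j') h : bideg n) z => /= ->.
  exact: (@dsum_lift_in _ (@ct_summand _ X Y n)).
rewrite ct_in_out // raddf0 tensor_map0 // => x y /=.
have [i'i|i'i] := eqVneq i' i; last by rewrite (@tr_neq _ X _ _ _ i'i) tens0l.
have [j'j|j'j] := eqVneq j' j; last by rewrite (@tr_neq _ Y _ _ _ j'j) tens0r.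
by rewrite i'i j'j ijn eqxx in h.
Qed.

Lemma ct_proj_tens n i j i' j' x y : i + j = n ->
  ct_proj i j (ct_in n (tens x y : tensor (X i') (Y j'))) = tens (tr i x) (tr j y).
Proof. by move=> h; rewrite ct_projE // tensor_mapE. Qed.

Lemma ct_proj_dl m i j z : i + j = m ->
  ct_proj i j (ct_dl X Y (m + 1) m z) =
  tensor_map (cdiff X (i + 1) i) idfun (ct_proj (i + 1) j z).
Proof.
move=> ijm; elim/ct_ind: z => [|y z yE zE|i' j' x y _]; first by rewrite !raddf0.
  by rewrite !raddfB /= yE zE.
rewrite ct_dlE !ct_proj_tens ?tensor_mapE ?tr_cdiff //.
by rewrite -ijm addrAC.
Qed.

Lemma ct_proj_dr m i j z : i + j = m ->
  ct_proj i j (ct_dr X Y (m + 1) m z) =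
  tensor_map idfun (cdiff Y (j + 1) j) (ct_proj i (j + 1) z) *~ (-1) ^+ `|i|.
Proof.
move=> ijm; elim/ct_ind: z => [|y z yE zE|i' j' x y _].
- by rewrite !raddf0 mul0rz.
- by rewrite !raddfB /= yE zE mulrzBl.
rewrite ct_drE raddfMz /= !ct_proj_tens ?tensor_mapE ?tr_cdiff //; last first.
  by rewrite -ijm addrA.
have [e|h] := eqVneq i' i; first by subst i'.
by rewrite /= (tr_neq _ h) !tens0l !mul0rz.
Qed.

Lemma ct_sum n (z : ct_obj X Y n) : exists s : seq (bideg n),
  z = \sum_(p <- s) ct_in n (ct_proj (val p).1 (val p).2 z).
Proof.
(* Allowing every duplicate-free list that contains [s] lets the supports of two elements be merged
   when their difference is treated. *)
suff [s sP] : exists s : seq (bideg n), forall s', uniq s' -> {subset s <= s'} ->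
    z = \sum_(p <- s') ct_in n (ct_proj (val p).1 (val p).2 z).
  by exists (undup s); apply: sP; [exact: undup_uniq|move=> p; rewrite mem_undup].
move: z; apply: ct_ind => [|y z [s sP] [t tP]|i j x y /eqP ijn].
- by exists [::] => s _ _; rewrite big1 // => p _; rewrite !raddf0.
- exists (s ++ t) => u uu su; rewrite {1}[y](sP u) //; last first.
    by move=> p ps; apply: su; rewrite mem_cat ps.
  rewrite {1}[z](tP u) //; last by move=> p ps; apply: su; rewrite mem_cat ps orbT.
  by rewrite -sumrB; apply: eq_bigr => p _; rewrite [ct_proj _ _ (y - z)]raddfB raddfB.
- pose p0 : bideg n := exist _ (i, j) ijn.
  exists [:: p0] => s us /(_ p0 (mem_head _ _)) p0s.
  rewrite (bigD1_seq p0) //= big1 ?addr0.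
    by rewrite ct_proj_tens ?(eqP ijn) // !tr_id.
  move=> p pp0; rewrite ct_proj_tens; last exact/eqP/(valP p).
  have [ip|h] := eqVneq i (val p).1; last by rewrite (tr_neq _ h) tens0l raddf0.
  have [jp|h] := eqVneq j (val p).2; last by rewrite (tr_neq _ h) tens0r raddf0.
  by case/eqP: pp0; apply: val_inj; rewrite /= ip jp -surjective_pairing.
Qed.

Lemma ct_eq0 n (z : ct_obj X Y n) :
  (forall i j, i + j = n -> ct_proj i j z = 0) -> z = 0.
Proof.
move=> z0; have [s ->] := ct_sum z; rewrite big1 // => p _.
by rewrite z0 ?raddf0 //; apply/eqP/(valP p).
Qed.
End TensorComplex.

Section TensorComplexMap.
Variables (R : pzRingType) (Y : complex R).
Implicit Types X : complex R^c.

Lemma ct_proj_map X X' (f : chain_map X X') n i j (z : ct_obj X Y n) :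
  i + j = n ->
  ct_proj i j (ct_map f z) = tensor_map (f i) idfun (ct_proj i j z).
Proof.
move=> ijn; elim/ct_ind: z => [|y z yE zE|i' j' x y _]; first by rewrite !raddf0.
  by rewrite !raddfB /= yE zE.
by rewrite ct_mapE !ct_proj_tens // tensor_mapE tr_natural.
Qed.

Lemma ct_map_comp X X' X'' (f : chain_map X X') (g : chain_map X' X'')
    (h : chain_map X X'') :
  (forall n x, g n (f n x) = h n x) ->
  forall n (z : ct_obj X Y n), ct_map g (ct_map f z) = ct_map h z.
Proof.
move=> fgh n; apply: ct_ind => [|y z yE zE|i j x y _]; first by rewrite !raddf0.
  by rewrite !raddfB /= yE zE.
by rewrite !ct_mapE fgh.
Qed.

Lemma ct_map_in X X' (f : chain_map X X') n i j (z : tensor (X i) (Y j)) :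
  ct_map f (ct_in n z) = ct_in n (tensor_map (f i) idfun z).
Proof.
elim/tensor_ind: z => [|y z yE zE|x y]; first by rewrite !raddf0.
  by rewrite !raddfB /= yE zE.
by rewrite ct_mapE tensor_mapE.
Qed.

Lemma ct_map_surj X X' (f : chain_map X X') :
  chain_surjection f -> forall n, surjection (@ct_map _ _ _ f Y n).
Proof.
move=> fs n; apply: ct_ind => [|y z [u <-] [v <-]|i j x y _].
- by exists 0; rewrite raddf0.
- by exists (u - v); rewrite raddfB.
- by have [x' <-] := fs i x; exists (ct_in n (tens x' y)); rewrite ct_mapE.
Qed.

Lemma ct_map_ker K X X' (k : chain_map K X) (f : chain_map X X') n (z : ct_obj X Y n) :
  chain_surjection f ->
  (forall n x, f n x = 0 -> exists y, k n y = x) ->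
  ct_map f z = 0 -> exists w, ct_map k w = z.
Proof.
move=> fs kf fz; have [s ->] := ct_sum z.
pose H u := exists w : ct_obj K Y n, ct_map k w = u.
apply: (big_ind H) => [|_ _ [u <-] [v <-]|p _].
- by exists 0; rewrite raddf0.
- by exists (u + v); rewrite raddfD.
have hp : (val p).1 + (val p).2 = n by apply/eqP/(valP p).
have : tensor_map (f (val p).1) idfun (ct_proj (val p).1 (val p).2 z) = 0.
  by rewrite -ct_proj_map // fz raddf0.
case/(tensor_rexact_l (fs _) (kf _)) => w <-.
by exists (ct_in n w); rewrite ct_map_in.
Qed.

Lemma ct_map_inj X X' (f : chain_map X X') :
  (forall i j (z : tensor (X i) (Y j)), tensor_map (f i) idfun z = 0 -> z = 0) ->
  forall n (z : ct_obj X Y n), ct_map f z = 0 -> z = 0.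
Proof.
move=> fi n z fz; apply: ct_eq0 => i j ijn; apply: fi.
by rewrite -ct_proj_map // fz raddf0.
Qed.

Lemma bt_map_surj X X' (f : chain_map X X') :
  chain_surjection f -> forall n, surjection (@bt_map _ _ _ f Y n).
Proof.
move=> fs n q; have [z <-] := zpi_surj q.
have [w <-] := ct_map_surj fs z.
by exists (zpi _ w); rewrite bt_mapE.
Qed.

Lemma bt_pi_eq0 X n (z : ct_obj X Y n) :
  zpi (ct_boundary X Y n) z = 0 -> exists w, ct_diff X Y (n + 1) n w = z.
Proof.
move/zpi_eq0P; apply: (in_zspan_closed (H := fun z => exists w, _ = z)).
- by exists 0; rewrite raddf0.
- by move=> ? ? [u <-] [v <-]; exists (u - v); rewrite raddfB.
- by move=> _ [w]; exists w.
Qed.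

Lemma bt_pi_diff X n (w : ct_obj X Y (n + 1)) :
  zpi (ct_boundary X Y n) (ct_diff X Y (n + 1) n w) = 0.
Proof. exact/zpi_gen/CtBoundary. Qed.

(** Right exactness of the modified tensor product: if the image of z bounds w', then w' lifts along
    the surjection, and subtracting the boundary of the lift moves z into the kernel of [ct_map f]
    without changing its class. *)
Lemma bt_map_ker K X X' (k : chain_map K X) (f : chain_map X X') n (z : bt_obj X Y n) :
  chain_surjection f ->
  (forall n x, f n x = 0 -> exists y, k n y = x) ->
  bt_map f z = 0 -> exists w, bt_map k w = z.
Proof.
move=> fs kf; have [{}z <-] := zpi_surj z.
rewrite bt_mapE => /bt_pi_eq0[w']; have [w <-] := ct_map_surj fs w'.
rewrite -[LHS]ct_map_comm /= => /esym/eqP; rewrite -subr_eq0 -raddfB => /eqP.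
case/(ct_map_ker fs kf) => u uE; exists (zpi _ u).
by rewrite bt_mapE uE raddfB /= bt_pi_diff subr0.
Qed.
End TensorComplexMap.

(** * Kernels and the vanishing of Tor *)

Section KernelModule.
Variables (R : pzRingType) (U V : lmodType R) (f : {linear U -> V}).

Definition ker_incl : {linear ker_of f -> U} := \val.

Lemma ker_inclP k : f (ker_incl k) = 0.
Proof. exact/eqP/(valP k). Qed.

Lemma ker_incl_inj : injective ker_incl.
Proof. exact: val_inj. Qed.

Lemma ker_of_eta x : f x = 0 -> exists k, ker_incl k = x.
Proof. by move/eqP => fx; exists (KerOf (fx : x \in kerp f)). Qed.

Section Lift.
Variables (W : lmodType R) (g : {linear W -> U}).
Hypothesis fg0 : forall w, f (g w) = 0.

Lemma ker_lift_subproof w : g w \in kerp f.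
Proof. exact/eqP. Qed.

Definition ker_lift w : ker_of f := KerOf (ker_lift_subproof w).

Lemma ker_lift_linear : linear ker_lift.
Proof. by move=> a x y; apply: ker_incl_inj; rewrite linearP /= linearP. Qed.
HB.instance Definition _ :=
  GRing.isLinear.Build R W (ker_of f) *:%R ker_lift ker_lift_linear.

Lemma ker_liftE w : ker_incl (ker_lift w) = g w.
Proof. by []. Qed.
End Lift.
End KernelModule.
Arguments ker_incl {R U V} f.
Arguments ker_lift {R U V f W g} fg0 w.

Section ChainOps.
Variables (R : pzRingType).
Implicit Types X Y Z : complex R.

Lemma chain_comp_comm X Y Z (g : chain_map Y Z) (f : chain_map X Y) i j x :
  (g j \o f j) (cdiff X i j x) = cdiff Z i j ((g i \o f i) x).
Proof. by rewrite /= !chain_comm. Qed.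

Definition chain_comp X Y Z (g : chain_map Y Z) (f : chain_map X Y) : chain_map X Z :=
  @ChainMap R X Z (fun n => g n \o f n) (chain_comp_comm g f).

Lemma chain_subid_comm X (f : chain_map X X) i j x :
  (f j \- idfun) (cdiff X i j x) = cdiff X i j ((f i \- idfun) x).
Proof. by rewrite /= chain_comm raddfB. Qed.

Definition chain_subid X (f : chain_map X X) : chain_map X X :=
  @ChainMap R X X (fun n => f n \- idfun) (chain_subid_comm f).
End ChainOps.

Section KernelComplex.
Variables (R : pzRingType) (X Y : complex R) (f : chain_map X Y).

Lemma ker_cdiff_subproof i j (k : ker_of (f i)) :
  f j ((cdiff X i j \o ker_incl (f i)) k) = 0.
Proof. by rewrite /= chain_comm ker_inclP raddf0. Qed.

Definition ker_cdiff i j : {linear ker_of (f i) -> ker_of (f j)} :=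
  ker_lift (@ker_cdiff_subproof i j).

Lemma ker_cdiff_shape i j : i != j + 1 -> forall k, ker_cdiff i j k = 0.
Proof. by move=> h k; apply: ker_incl_inj; rewrite ker_liftE /= cdiff_shape. Qed.

Lemma ker_cdiffK i j l k : ker_cdiff j l (ker_cdiff i j k) = 0.
Proof. by apply: ker_incl_inj; rewrite ker_liftE /= cdiffK. Qed.

Definition ker_complex : complex R :=
  @Complex R (fun n => ker_of (f n)) ker_cdiff ker_cdiff_shape ker_cdiffK.

Definition ker_cincl : chain_map ker_complex X :=
  @ChainMap R ker_complex X (fun n => ker_incl (f n)) (fun _ _ _ => erefl).

Section Lift.
Variables (W : complex R) (g : chain_map W X).
Hypothesis fg0 : forall n w, f n (g n w) = 0.

Lemma ker_clift_comm i j w :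
  ker_lift (@fg0 j) (cdiff W i j w) = cdiff ker_complex i j (ker_lift (@fg0 i) w).
Proof. by apply: ker_incl_inj; rewrite !ker_liftE chain_comm. Qed.

Definition ker_clift : chain_map W ker_complex :=
  @ChainMap R W ker_complex (fun n => ker_lift (@fg0 n)) ker_clift_comm.
End Lift.
End KernelComplex.
Arguments ker_clift {R X Y f W g} fg0.

(** Here p identifies K with the cokernel of d2, and k is the map that d1 induces on it. *)
Lemma exact_iff_inj (A2 A1 K A0 : zmodType) (d2 : {additive A2 -> A1})
    (d1 : {additive A1 -> A0}) (p : {additive A1 -> K}) (k : {additive K -> A0}) :
  (forall z, k (p z) = d1 z) -> surjection p ->
  (forall z, p z = 0 <-> exists w, d2 w = z) ->
  (forall z, d1 z = 0 -> exists w, d2 w = z) <-> (forall z, k z = 0 -> z = 0).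
Proof.
move=> kp ps pd; split=> [ex z kz|ki z dz].
  have [y yz] := ps z; have /ex/pd : d1 y = 0 by rewrite -kp yz.
  by rewrite yz.
by apply/pd/ki; rewrite kp.
Qed.

Section TorKernel.
Variable R : pzRingType.

Lemma res_diff_aug (S : pzRingType) (M : lmodType S) (P : resolution M) x :
  res_aug P (res_diff P 0 x) = 0.
Proof. by apply/res_exact0; exists x. Qed.

(** The kernel of the augmentation is the cokernel of P_2 -> P_1, and tensoring with N preserves
    cokernels. *)
Lemma Tor1_inj (M : lmodType R^c) (N : lmodType R) (P : resolution M) :
  (forall z : tensor (P 1%N) N, tensor_map (res_diff P 0) idfun z = 0 ->
    exists w : tensor (P 2%N) N, tensor_map (res_diff P 1) idfun w = z) <->
  (forall z : tensor (ker_of (res_aug P)) N,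
    tensor_map (ker_incl (res_aug P)) idfun z = 0 -> z = 0).
Proof.
pose p : {linear P 1%N -> ker_of (res_aug P)} := ker_lift (@res_diff_aug _ _ P).
have ps : surjection p.
  move=> k; have /res_exact0[y yE] := ker_inclP k.
  by exists y; apply: ker_incl_inj; rewrite ker_liftE.
have pE y : (p y = 0) <-> (res_diff P 0 y = 0).
  split=> [/(congr1 (ker_incl _))|py]; first by rewrite ker_liftE raddf0.
  by apply: ker_incl_inj; rewrite ker_liftE py raddf0.
have ids : surjection (idfun : N -> N) by move=> y; exists y.
apply: (exact_iff_inj (p := tensor_map p idfun)) => [z||z].
- exact: tensor_map_comp.
- exact: tensor_map_surj.
- split=> [|[w <-]]; last first.
    rewrite /= (tensor_map_comp (f'' := \0) (g'' := idfun)) //.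
      by apply: tensor_map0 => x y; rewrite tens0l.
    by move=> x; apply/pE/res_exact; exists x.
  by apply: tensor_rexact_l => // x /pE/res_exact.
Qed.

Lemma bt_map_comp (Y : complex R) (X X' X'' : complex R^c) (f : chain_map X X')
    (g : chain_map X' X'') (h : chain_map X X'') :
  (forall n x, g n (f n x) = h n x) ->
  forall n (z : bt_obj X Y n), bt_map g (bt_map f z) = bt_map h z.
Proof.
move=> fgh n z; have [{}z <-] := zpi_surj z.
by rewrite !bt_mapE (ct_map_comp fgh).
Qed.

Lemma cres_diff_aug (S : pzRingType) (X : complex S) (P : complex_resolution X) n x :
  cres_aug P n (cres_diff P 0 n x) = 0.
Proof. by apply/cres_exact0; exists x. Qed.

Lemma barTor1_inj (X : complex R^c) (L : complex R) (P : complex_resolution X) n :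
  (forall z : bartensor (P 1%N) L n, bartensor_map (cres_diff P 0) L n z = 0 ->
    exists w : bartensor (P 2%N) L n, bartensor_map (cres_diff P 1) L n w = z) <->
  (forall z : bt_obj (ker_complex (cres_aug P)) L n,
    bt_map (ker_cincl (cres_aug P)) z = 0 -> z = 0).
Proof.
pose p : chain_map (P 1%N) (ker_complex (cres_aug P)) :=
  ker_clift (@cres_diff_aug _ _ P).
have ps : chain_surjection p.
  move=> i k; have /cres_exact0[y yE] := ker_inclP k.
  by exists y; apply: ker_incl_inj; rewrite ker_liftE.
have pE i y : (p i y = 0) <-> (cres_diff P 0 i y = 0).
  split=> [/(congr1 (ker_incl _))|py]; first by rewrite ker_liftE raddf0.
  by apply: ker_incl_inj; rewrite ker_liftE py raddf0.
apply: (exact_iff_inj (p := @bt_map _ _ _ p L n)) => [z||z].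
- exact: bt_map_comp.
- exact: bt_map_surj.
- split=> [|[w <-]].
    by apply: bt_map_ker => // i x /pE/cres_exact.
  have [{}w <-] := zpi_surj w.
  rewrite -[LHS]/(bt_map p (bt_map (cres_diff P 1) (zpi _ w))) !bt_mapE.
  suff -> : ct_map p (ct_map (cres_diff P 1) w) = 0 by rewrite (raddf0 (zpi _)).
  pose F : {additive ct_obj (P 2%N) L n -> _} := @ct_map _ _ _ p L n \o
    @ct_map _ _ _ (cres_diff P 1) L n.
  rewrite -[LHS]/(F w) -[RHS]/((\0 : {additive ct_obj (P 2%N) L n -> _}) w).
  move: w; apply: ct_ext => i j x y.
  rewrite -[LHS]/(ct_map p (ct_map (cres_diff P 1) (ct_in n (tens x y)))) !ct_mapE.
  have /pE -> : cres_diff P 0 i (cres_diff P 1 i x) = 0.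
    by apply/cres_exact; exists x.
  by rewrite tens0l (raddf0 (@ct_in _ _ _ n i j)).
Qed.

(** For [P] projective and [e] surjective, this says that the first derived functor vanishes at X,
    using only one step of a resolution. *)
Definition bar_flat_kernel (X P : complex R^c) (e : chain_map P X) (L : complex R) :=
  forall n (z : bt_obj (ker_complex e) L n), bt_map (ker_cincl e) z = 0 -> z = 0.

(* The maps P -> Q -> P over X give f and g on kernels, and gf - 1 factors     *)
(* through the inclusion of the kernel into P.                                 *)
Lemma bar_flat_kernel_indep (X P Q : complex R^c) (eP : chain_map P X)
    (eQ : chain_map Q X) (L : complex R) :
  projective_complex P -> projective_complex Q ->
  chain_surjection eP -> chain_surjection eQ ->
  bar_flat_kernel eQ L -> bar_flat_kernel eP L.
Proof.
move=> pP pQ sP sQ injQ n z iz.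
have [f fE] := pP _ _ _ eP sQ; have [g gE] := pQ _ _ _ eQ sP.
have f0 m w : eQ m (chain_comp f (ker_cincl eP) m w) = 0.
  by rewrite /= fE ker_inclP.
have g0 m w : eP m (chain_comp g (ker_cincl eQ) m w) = 0.
  by rewrite /= gE ker_inclP.
have h0 m w : eP m (chain_subid (chain_comp g f) m w) = 0.
  by rewrite /= raddfB /= gE fE subrr.
have fz : bt_map (ker_clift f0) z = 0.
  apply: injQ; transitivity (bt_map (chain_comp f (ker_cincl eP)) z).
    exact: bt_map_comp.
  transitivity (bt_map f (bt_map (ker_cincl eP) z)); first exact/esym/bt_map_comp.
  exact: etrans (congr1 (@bt_map _ _ _ f L n) iz) (raddf0 _).
(* On the kernel, gf - 1 followed by nothing else is the difference below; the left side dies by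
   [iz] and the composite on the right by [fz], leaving z = 0. *)
have hE : bt_map (ker_clift h0) (bt_map (ker_cincl eP) z) =
    bt_map (ker_clift g0) (bt_map (ker_clift f0) z) - z.
  move: z {iz fz} => z; have [{}z <-] := zpi_surj z.
  rewrite !bt_mapE -(raddfB (zpi _)); congr (zpi _ _).
  pose F : {additive _ -> _} := @ct_map _ _ _ (ker_clift h0) L n \o
    @ct_map _ _ _ (ker_cincl eP) L n.
  pose G : {additive _ -> _} :=
    (@ct_map _ _ _ (ker_clift g0) L n \o @ct_map _ _ _ (ker_clift f0) L n) \- idfun.
  rewrite -[LHS]/(F z) -[RHS]/(G z).
  move: z; apply: ct_ext => i j x y.
  rewrite -[LHS]/(ct_map _ (ct_map _ _)) -[RHS]/(ct_map _ (ct_map _ _) - _) !ct_mapE.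
  apply: etrans (raddfB (@ct_in R (ker_complex eP) L n i j) _ _).
  rewrite -tensBl; congr (ct_in _ (tens _ _)).
  by apply: ker_incl_inj; rewrite raddfB.
by move/eqP: hE; rewrite iz fz !raddf0 sub0r eq_sym oppr_eq0 => /eqP.
Qed.
End TorKernel.

(** * Projective modules and complexes *)

Section LinearPair.
Variables (R : pzRingType) (U V W : lmodType R).

Section Pair.
Variables (f : {linear U -> V}) (g : {linear U -> W}).

Definition lin_pair (x : U) : V * W := (f x, g x).

Lemma lin_pair_linear : linear lin_pair.
Proof. by move=> a x y; rewrite /lin_pair !linearP. Qed.
HB.instance Definition _ :=
  GRing.isLinear.Build R U (V * W)%type *:%R lin_pair lin_pair_linear.
End Pair.

Section Copair.
Variables (f : {linear V -> U}) (g : {linear W -> U}).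

Definition lin_copair (p : V * W) : U := f p.1 + g p.2.

Lemma lin_copair_linear : linear lin_copair.
Proof.
by move=> a [x y] [x' y']; rewrite /lin_copair /= !linearP /= scalerDr addrACA.
Qed.
HB.instance Definition _ :=
  GRing.isLinear.Build R (V * W)%type U *:%R lin_copair lin_copair_linear.
End Copair.

Lemma lin_copair_surj (f : {linear V -> U}) (g : {linear W -> U}) :
  surjection f -> surjection (lin_copair f g).
Proof.
move=> fs u; have [v <-] := fs u.
by exists (v, 0); rewrite /lin_copair /= raddf0 addr0.
Qed.
End LinearPair.

Section ProjectiveModules.
Variable R : pzRingType.
Implicit Types M P Q : lmodType R.

Lemma projective_prod P Q : projective P -> projective Q -> projective (P * Q)%type.
Proof.
move=> pP pQ A B g f gs.
pose i1 : {linear P -> (P * Q)%type} := lin_pair idfun \0.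
pose i2 : {linear Q -> (P * Q)%type} := lin_pair \0 idfun.
have [h hE] := pP A B g (f \o i1) gs; have [k kE] := pQ A B g (f \o i2) gs.
exists (lin_copair h k) => -[x y] /=.
rewrite /lin_copair raddfD /= hE kE /= -raddfD; congr (f _).
by rewrite /lin_pair /=; congr pair; rewrite ?addr0 ?add0r.
Qed.

Lemma projective_triv M : (forall x : M, x = 0) -> projective M.
Proof.
move=> M0 A B g f gs; exists \0 => x.
by rewrite (M0 x) !raddf0.
Qed.

Lemma fin_gen_triv M : (forall x : M, x = 0) -> fin_gen M.
Proof.
move=> M0; exists 0%N, (fun=> 0) => x; exists (fun=> 0).
by rewrite big_ord0 (M0 x).
Qed.

Lemma fin_gen_prod P Q : fin_gen P -> fin_gen Q -> fin_gen (P * Q)%type.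
Proof.
move=> [n [g gP]] [m [h hQ]].
exists (n + m)%N, (fun i => match split i with
  | inl j => (g j, 0) : (P * Q)%type | inr j => (0, h j) end).
move=> [x y]; have [c ->] := gP x; have [d ->] := hQ y.
exists (fun i => match split i with inl j => c j | inr j => d j end).
rewrite big_split_ord /=.
have sl (i : 'I_n) : split (lshift m i) = inl i := unsplitK (inl i).
have sr (i : 'I_m) : split (rshift n i) = inr i := unsplitK (inr i).
under [X in _ = X + _]eq_bigr do rewrite sl.
under [X in _ = _ + X]eq_bigr do rewrite sr.
have e1 : \sum_(i < n) c i *: (g i, 0) = (\sum_(i < n) c i *: g i, 0) :> (P * Q)%type.
  pose i1 : {linear P -> (P * Q)%type} := lin_pair idfun \0.
  rewrite -[RHS]/(i1 _) linear_sum; apply: eq_bigr => i _.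
  by rewrite linearZ_LR.
have e2 : \sum_(i < m) d i *: (0, h i) = (0, \sum_(i < m) d i *: h i) :> (P * Q)%type.
  pose i2 : {linear Q -> (P * Q)%type} := lin_pair \0 idfun.
  rewrite -[RHS]/(i2 _) linear_sum; apply: eq_bigr => i _.
  by rewrite linearZ_LR.
rewrite e1 e2; congr pair; first by rewrite addr0.
by rewrite add0r.
Qed.

(* A section of R^n -> P gives coordinate functions on P: a dual basis.        *)
Lemma dual_basis P : projective P -> fin_gen P ->
  exists (n : nat) (g : 'I_n -> P) (c : 'I_n -> P -> R),
    [/\ forall i x y, c i (x + y) = c i x + c i y,
        forall i r x, c i (r *: x) = r * c i x &
        forall x, x = \sum_(i < n) c i x *: g i].
Proof.
move=> pP [n [g gP]].
pose e0 (v : 'rV[R]_n) := \sum_(i < n) v 0 i *: g i.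
have e0l : linear e0.
  move=> a u v; rewrite /e0 scaler_sumr -big_split; apply: eq_bigr => i _ /=.
  by rewrite !mxE scalerDl scalerA.
have es : surjection (mk_linear e0l).
  move=> x; have [c ->] := gP x; exists (\row_i c i).
  by apply: eq_bigr => i _; rewrite mxE.
have [h hE] := pP _ _ (mk_linear e0l) idfun es.
exists n, g, (fun i x => h x 0 i); split=> [i x y|i r x|x].
- by rewrite raddfD mxE.
- by rewrite linearZ mxE.
- exact/esym/hE.
Qed.
End ProjectiveModules.

(* The two complexes below sum the discs on B (resp. F n) in degrees n + 1, n: *)
(* a chain map into the first (out of the second) is just a family of linear   *)
(* maps into B (out of the F n).                                               *)

Section CoDisc.
Variables (R : pzRingType).

Section Def.
Variables (B : lmodType R).

Definition codisc_diff_snd (i j : int) (p : B * B) : B := p.1 *+ (i == j + 1).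

Lemma codisc_diff_snd_linear i j : linear (codisc_diff_snd i j).
Proof.
by move=> a x y; rewrite /codisc_diff_snd /= mulrnDl scalerMnr.
Qed.

Definition codisc_diff i j : {linear (B * B)%type -> (B * B)%type} :=
  lin_pair \0 (mk_linear (codisc_diff_snd_linear i j)).

Lemma codisc_diffE i j p : codisc_diff i j p = (0, p.1 *+ (i == j + 1)).
Proof. by []. Qed.

Lemma codisc_shape i j : i != j + 1 -> forall p, codisc_diff i j p = 0.
Proof. by move=> /negPf h p; rewrite codisc_diffE h. Qed.

Lemma codisc_diffK i j k p : codisc_diff j k (codisc_diff i j p) = 0.
Proof. by rewrite !codisc_diffE mul0rn. Qed.

Definition codisc : complex R :=
  @Complex R (fun=> (B * B)%type) codisc_diff codisc_shape codisc_diffK.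
End Def.

Section Map.
Variables (P : complex R) (B : lmodType R) (u : forall n, {linear P n -> B}).

Definition codisc_map_fun n : {linear P n -> codisc B n} :=
  lin_pair (u (n - 1) \o cdiff P n (n - 1)) (u n).

Lemma codisc_map_comm i j x :
  codisc_map_fun j (cdiff P i j x) = cdiff (codisc B) i j (codisc_map_fun i x).
Proof.
rewrite -[LHS]/((_, _)) -[RHS]/((_, _)) /= cdiffK raddf0; congr pair.
rewrite /codisc_diff_snd /=; have [e|h] := eqVneq i (j + 1); last first.
  by rewrite cdiff_shape // raddf0.
by subst i; rewrite mulr1n addrK.
Qed.

Definition codisc_map : chain_map P (codisc B) := ChainMap codisc_map_comm.
End Map.

(** Precomposed with [tr], f becomes a family of maps concentrated in degree i, hence a chain map
    into [codisc B]. Lifting it through [codisc A] and taking the second coordinate in degree i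
    lifts f. *)
Lemma projective_complex_obj (P : complex R) :
  projective_complex P -> forall i, projective (P i).
Proof.
move=> pP i A B g f gs.
have gc j k x : lin_pair (g \o fst) (g \o snd) (cdiff (codisc A) j k x) =
    cdiff (codisc B) j k (lin_pair (g \o fst) (g \o snd) x).
  rewrite /= /lin_pair /=; congr pair; first exact: raddf0.
  by rewrite [LHS]raddfMn.
pose G : chain_map (codisc A) (codisc B) := @ChainMap _ (codisc A) (codisc B) (fun=> _) gc.
have Gs : chain_surjection G.
  move=> n [x y]; have [x' <-] := gs x; have [y' <-] := gs y.
  by exists (x', y').
have [h hE] := pP _ _ G (codisc_map (fun n => f \o @tr _ P n i)) Gs.
exists (snd \o h i) => x.
by have /(congr1 snd) /= := hE i x; rewrite tr_id.
Qed.
End CoDisc.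

(** * Complexes of type FP_oo *)

Section DiscSum.
Variables (R : pzRingType) (F : int -> lmodType R).

Definition disc_diff i j : {linear (F i * F (i + 1))%type -> (F j * F (j + 1))%type} :=
  lin_pair \0 (@tr _ F i (j + 1) \o fst).

Lemma disc_diffE i j p : disc_diff i j p = (0, tr (j + 1) p.1).
Proof. by []. Qed.

Lemma disc_shape i j : i != j + 1 -> forall p, disc_diff i j p = 0.
Proof. by move=> h p; rewrite disc_diffE tr_neq. Qed.

Lemma disc_diffK i j k p : disc_diff j k (disc_diff i j p) = 0.
Proof. by rewrite !disc_diffE /= raddf0. Qed.

Definition disc_sum : complex R :=
  @Complex R (fun n => (F n * F (n + 1))%type) disc_diff disc_shape disc_diffK.

Section Map.
Variables (X : complex R) (u : forall n, {linear F n -> X n}).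

Definition disc_map_fun n : {linear disc_sum n -> X n} :=
  lin_copair (u n) (cdiff X (n + 1) n \o u (n + 1)).

Lemma disc_map_comm i j p :
  disc_map_fun j (cdiff disc_sum i j p) = cdiff X i j (disc_map_fun i p).
Proof.
rewrite /= /lin_copair /= raddf0 add0r raddfD /= cdiffK addr0.
have [e|h] := eqVneq i (j + 1); first by subst i; rewrite tr_id.
by rewrite tr_neq // !raddf0 cdiff_shape.
Qed.

Definition disc_map : chain_map disc_sum X := ChainMap disc_map_comm.

Lemma disc_map_surj : (forall n, surjection (u n)) -> chain_surjection disc_map.
Proof. by move=> us n; apply: lin_copair_surj. Qed.
End Map.

Lemma projective_disc_sum : (forall n, projective (F n)) -> projective_complex disc_sum.
Proof.
move=> pF A B g f gs.
have lift n : exists u : {linear F n -> A n},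
    forall x, g n (u x) = f n (lin_pair idfun \0 x).
  exact: (pF n _ _ (g n) (f n \o lin_pair idfun \0) (gs n)).
pose u n := sval (cid (lift n)).
pose uE n := svalP (cid (lift n)) : forall x, g n (u n x) = _.
exists (disc_map u) => n [x y].
rewrite /= /lin_copair /= raddfD /= chain_comm !uE -chain_comm -raddfD.
congr (f n _); rewrite /= disc_diffE /= tr_id.
by congr pair; rewrite ?addr0 ?add0r.
Qed.
End DiscSum.

Section FPModules.
Variable R : pzRingType.

Lemma triv_resolution (M : lmodType R) : (forall x : M, x = 0) ->
  exists P : resolution M, forall k (x : P k), x = 0.
Proof.
move=> M0.
have ex (x : M) : x = 0 <-> exists y : M, 0 = x.
  by split=> _; [exists 0; rewrite (M0 x)|apply: M0].
unshelve eexists (@Resolution R M (fun=> M) (fun=> \0) idfun _ _ _ _) => //.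
- by move=> k; apply: projective_triv.
- by move=> x; exists x.
- by move=> k x; split=> _ //; apply/ex/M0.
Qed.

Lemma FP_infty_triv (M : lmodType R) : (forall x : M, x = 0) -> FP_infty M.
Proof.
by move=> /triv_resolution[P P0]; exists P => k; apply: fin_gen_triv.
Qed.

(** Choosing the zero resolution for a zero module keeps the degreewise covers of a bounded complex
    bounded. *)
Lemma FP_infty_cover (M : lmodType R) : FP_infty M ->
  exists P : resolution M, (forall k, fin_gen (P k)) /\
    ((forall x : M, x = 0) -> forall x : P 0%N, x = 0).
Proof.
move=> [P Pfg]; have [M0|nM0] := pselect (forall x : M, x = 0); last first.
  by exists P; split.
have [Q Q0] := triv_resolution M0.
by exists Q; split=> // k; apply: fin_gen_triv.
Qed.

Section Kernel.
Variables (M : lmodType R) (P : resolution M) (G : lmodType R).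
Variables (d : {linear G -> M}) (s : {linear G -> P 0%N}).
Hypothesis sE : forall y, res_aug P (s y) = d y.
Hypothesis pG : projective G.

Let K := ker_of (lin_copair (res_aug P) d).

(** The lift [s] of [d] splits the kernel as ker([res_aug P]) plus G, through (x, y) -> (x - s y,
    y). It is thus resolved by P shifted by one, with G added in degree 0. *)
Definition kres_obj k : lmodType R :=
  match k with 0%N => (P 1%N * G)%type | k'.+1 => P k'.+2 end.

Definition kres_diff k : {linear kres_obj k.+1 -> kres_obj k} :=
  match k with 0%N => lin_pair (res_diff P 1) \0 | k'.+1 => res_diff P k'.+2 end.

Definition kres_aug_pre : {linear (P 1%N * G)%type -> (P 0%N * G)%type} :=
  lin_pair (lin_copair (res_diff P 0) (\- s)) snd.

Lemma kres_aug_subproof p : lin_copair (res_aug P) d (kres_aug_pre p) = 0.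
Proof.
rewrite -[LHS]/(res_aug P (res_diff P 0 p.1 - s p.2) + d p.2).
by rewrite linearB /= res_diff_aug sE sub0r addNr.
Qed.

Definition kres_aug : {linear kres_obj 0 -> K} := ker_lift kres_aug_subproof.

Lemma kres_proj k : projective (kres_obj k).
Proof. by case: k => [|k]; [apply: projective_prod => //|]; apply: res_proj. Qed.

Lemma kres_aug_surj : surjection kres_aug.
Proof.
move=> k; have := ker_inclP k; case E: (ker_incl _ k) => [x y].
rewrite -[X in X = 0]/(res_aug P x + d y) -sE -linearD => /res_exact0[p pE].
exists (p, y); apply: ker_incl_inj; rewrite ker_liftE E.
by rewrite -[LHS]/(res_diff P 0 p - s y, y) pE addrK.
Qed.

Lemma kres_exact0 x : kres_aug x = 0 <-> exists y, kres_diff 0 y = x.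
Proof.
split=> [/(congr1 (ker_incl _))|[y <-]].
  rewrite ker_liftE raddf0; case: x => p y.
  rewrite -[LHS]/(res_diff P 0 p - s y, y) => -[+ y0]; rewrite y0 raddf0 subr0.
  by case/res_exact => q <-; exists q.
apply: ker_incl_inj; rewrite ker_liftE raddf0.
rewrite -[LHS]/(res_diff P 0 (res_diff P 1 y) - s 0, 0).
have /res_exact -> : exists q, res_diff P 1 q = res_diff P 1 y by exists y.
by rewrite raddf0 subr0.
Qed.

Lemma kres_exact k x : kres_diff k x = 0 <-> exists y, kres_diff k.+1 y = x.
Proof.
case: k x => [|k] x; last exact: res_exact.
split=> [[] /res_exact//|/res_exact dx].
by rewrite -[LHS]/(res_diff P 1 x, 0) dx.
Qed.

Definition kres : resolution K :=
  @Resolution R K kres_obj kres_diff kres_aug kres_proj kres_aug_surj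
    kres_exact0 kres_exact.
End Kernel.

(** With G the cover of X_(n+1), this kernel is the degree n part of the kernel of a disc cover, so
    the FP_oo property passes to syzygies. *)
Lemma FP_infty_kernel (M : lmodType R) (P : resolution M) (G : lmodType R)
    (d : {linear G -> M}) :
  (forall k, fin_gen (P k)) -> projective G -> fin_gen G ->
  FP_infty (ker_of (lin_copair (res_aug P) d)).
Proof.
move=> Pfg pG fG; have [s sE] := pG _ _ (res_aug P) d (@res_aug_surj _ _ P).
exists (kres sE pG) => -[|k]; last exact: Pfg.
exact: fin_gen_prod.
Qed.

Definition bounded_complex (X : complex R) :=
  exists a b : int, forall n, ~~ (a <= n <= b) -> forall x : X n, x = 0.

Definition FP_bounded (X : complex R) :=
  bounded_complex X /\ forall n, FP_infty (X n).

Lemma FP_bounded_cover (X : complex R) : FP_bounded X ->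
  exists (P : complex R) (e : chain_map P X),
    [/\ projective_complex P, fin_gen_complex P, chain_surjection e &
        FP_bounded (ker_complex e)].
Proof.
move=> [[a [b X0]] FPX].
pose P n := sval (cid (FP_infty_cover (FPX n))).
have PP n : _ /\ _ := svalP (cid (FP_infty_cover (FPX n))).
have P0 n x : ~~ (a <= n <= b) -> x = 0 :> P n 0%N.
  by move=> /X0 Xn0; apply: (PP n).2.
pose F n := P n 0%N.
pose e : chain_map (disc_sum F) X := disc_map (fun n => res_aug (P n)).
(* Degree n of [disc_sum F] contains [F (n + 1)], so the lower bound drops by one. *)
have D0 n : ~~ (a - 1 <= n <= b) -> forall x : disc_sum F n, x = 0.
  move=> h [x y]; congr pair; apply: P0.
    by apply: contra h; lia.
  by apply: contra h; lia.
exists (disc_sum F), e; split.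
- by apply: projective_disc_sum => n; apply: res_proj.
- split=> [|n]; first by exists (a - 1), b.
  by apply: fin_gen_prod; apply: (PP _).1.
- by apply: disc_map_surj => n; apply: res_aug_surj.
- split=> [|n].
    by exists (a - 1), b => n h k; apply: ker_incl_inj; rewrite raddf0; apply: D0.
  by apply: FP_infty_kernel; [exact: (PP n).1|exact: res_proj|exact: (PP _).1].
Qed.

(** * Resolutions obtained by iterating covers within a class closed under kernels *)

Section Resolve.
Variables (C : complex R -> Prop).
Hypothesis coverC : forall X, C X -> exists (P : complex R) (e : chain_map P X),
  [/\ projective_complex P, fin_gen_complex P, chain_surjection e & C (ker_complex e)].

Record cover (X : complex R) := Cover {
  cov_obj : complex R;
  cov_map : chain_map cov_obj X;
  cov_proj : projective_complex cov_obj;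
  cov_fg : fin_gen_complex cov_obj;
  cov_surj : chain_surjection cov_map;
  cov_ker : C (ker_complex cov_map)
}.

Lemma cover_ex X : C X -> exists _ : cover X, True.
Proof. by move/coverC => [P [e [p f s c]]]; exists (@Cover X P e p f s c). Qed.

Definition a_cover (X : {X | C X}) : cover (sval X) :=
  sval (cid (@cover_ex (sval X) (svalP X))).

(** The proof of membership in [C] travels with the complex, since choosing the next cover requires
    it. *)
Fixpoint syzygy (X : {X | C X}) (k : nat) : {X | C X} :=
  match k with
  | 0%N => X
  | k'.+1 => exist C (ker_complex (cov_map (a_cover (syzygy X k')))) (cov_ker _)
  end.

Variables (X : complex R) (CX : C X).

Let S k := syzygy (exist C X CX) k.

Definition syz_diff k : chain_map (cov_obj (a_cover (S k.+1))) (cov_obj (a_cover (S k))) :=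
  chain_comp (ker_cincl (cov_map (a_cover (S k)))) (cov_map (a_cover (S k.+1))).

Lemma syz_exactness k n (x : cov_obj (a_cover (S k)) n) :
  cov_map (a_cover (S k)) n x = 0 <-> exists y, syz_diff k n y = x.
Proof.
split=> [/ker_of_eta[z zx]|[y <-]]; last exact: ker_inclP.
have [y yz] := @cov_surj _ (a_cover (S k.+1)) n z.
by exists y; rewrite -zx -yz.
Qed.

Lemma syz_exact k n x : syz_diff k n x = 0 <-> exists y, syz_diff k.+1 n y = x.
Proof.
rewrite -syz_exactness; split=> [h|h]; first by apply: ker_incl_inj; rewrite raddf0.
by rewrite -[LHS]/(ker_incl _ _) h raddf0.
Qed.

Lemma FP_infty_complex_of_covers : FP_infty_complex X.
Proof.
exists (@ComplexResolution R X (fun k => cov_obj (a_cover (S k))) syz_diff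
  (cov_map (a_cover (S 0))) (fun k => @cov_proj _ (a_cover (S k)))
  (@cov_surj _ (a_cover (S 0))) (@syz_exactness 0) syz_exact).
by move=> k; apply: cov_fg.
Qed.
End Resolve.

Lemma FP_bounded_FP_infty (X : complex R) : FP_bounded X -> FP_infty_complex X.
Proof. exact: (FP_infty_complex_of_covers FP_bounded_cover). Qed.

Definition obj_resolution (X : complex R) (P : complex_resolution X) n : resolution (X n) :=
  @Resolution R (X n) (fun k => P k n) (fun k => cres_diff P k n) (cres_aug P n)
    (fun k => @projective_complex_obj R _ (@cres_proj _ _ P k) n) (@cres_aug_surj _ _ P n)
    (@cres_exact0 _ _ P n) (fun k => @cres_exact _ _ P k n).

Lemma FP_infty_bounded (X : complex R) : FP_infty_complex X -> bounded_complex X.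
Proof.
move=> [P Pfg]; have [[a [b P0]] _] := Pfg 0%N.
exists a, b => n /P0 Pn x; have [y <-] := @cres_aug_surj _ _ P n x.
by rewrite (Pn y) raddf0.
Qed.
End FPModules.

(** * Level complexes are exact with level cycles *)

Section BarVanishing.
Variables (R : pzRingType) (X : complex R^c) (Y : complex R).

Lemma ct_dl_in m i j (k : int) (z : tensor (X i) (Y j)) : i = k + 1 ->
  ct_dl X Y (m + 1) m (ct_in (m + 1) z) =
  ct_in m (tensor_map (cdiff X i k) idfun z).
Proof.
move=> ik; have e : k = i - 1 by rewrite ik addrK.
subst k; elim/tensor_ind: z => [|y z yE zE|x y]; first by rewrite !raddf0.
  by rewrite !raddfB /= yE zE.
by rewrite ct_dlE tensor_mapE.
Qed.

Lemma ct_dr_in m i j (k : int) (z : tensor (X i) (Y j)) : j = k + 1 ->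
  ct_dr X Y (m + 1) m (ct_in (m + 1) z) =
  ct_in m (tensor_map idfun (cdiff Y j k) z) *~ (-1) ^+ `|i|.
Proof.
move=> jk; have e : k = j - 1 by rewrite jk addrK.
subst k; elim/tensor_ind: z => [|y z yE zE|x y]; first by rewrite !raddf0 mul0rz.
  by rewrite !raddfB /= yE zE mulrzBl.
by rewrite ct_drE tensor_mapE.
Qed.

(** A component of a boundary is a sum of a term coming from X_(i+1) (x) Y_j and, up to sign, one
    from X_i (x) Y_(j+1). As g kills both, it detects nonzero classes in the modified tensor
    product. *)
Lemma bt_pi_eq0_proj i j n (z : ct_obj X Y n) (B : zmodType)
    (g : {additive tensor (X i) (Y j) -> B}) :
  i + j = n ->
  (forall x y, g (tens (cdiff X (i + 1) i x) y) = 0) ->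
  (forall x y, g (tens x (cdiff Y (j + 1) j y)) = 0) ->
  zpi (ct_boundary X Y n) z = 0 -> g (ct_proj i j z) = 0.
Proof.
move=> ijn gl gr /bt_pi_eq0[w <-].
have gl0 (t : tensor (X (i + 1)) (Y j)) :
    g (tensor_map (cdiff X (i + 1) i) idfun t) = 0.
  elim/tensor_ind: t => [|y t yE tE|x y]; first by rewrite !raddf0.
    by rewrite !raddfB /= yE tE subr0.
  by rewrite tensor_mapE gl.
have gr0 (t : tensor (X i) (Y (j + 1))) :
    g (tensor_map idfun (cdiff Y (j + 1) j) t) = 0.
  elim/tensor_ind: t => [|y t yE tE|x y]; first by rewrite !raddf0.
    by rewrite !raddfB /= yE tE subr0.
  by rewrite tensor_mapE gr.
rewrite /ct_diff /= raddfD /= ct_proj_dl // ct_proj_dr // raddfD gl0 add0r.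
by rewrite raddfMz /= gr0 mul0rz.
Qed.
End BarVanishing.

(** * Modules placed in degree 0 and their disc covers *)

Section Sphere.
Variable R : pzRingType.

Definition sphere_obj (M : lmodType R) (n : int) : lmodType R :=
  match n with Posz 0 => M | _ => 'rV[R]_0 end.

Definition sphere (M : lmodType R) : complex R :=
  @Complex R (sphere_obj M) (fun _ _ => \0) (fun _ _ _ _ => erefl) (fun _ _ _ _ => erefl).

Definition sphere_map (P M : lmodType R) (f : {linear P -> M}) n :
    {linear sphere_obj P n -> sphere_obj M n} :=
  match n with Posz 0 => f | _ => \0 end.

Lemma sphere_triv (M : lmodType R) n : n != 0 -> forall x : sphere_obj M n, x = 0.
Proof. by case: n => [[|n]|n] // _ x; apply: thinmx0. Qed.

Lemma sphere_map_surj (P M : lmodType R) (f : {linear P -> M}) :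
  surjection f -> forall n, surjection (sphere_map f n).
Proof.
move=> fs n; have [->|n0] := eqVneq n 0; first exact: fs.
by move=> x; exists 0; rewrite raddf0 [RHS](sphere_triv n0).
Qed.

Lemma projective_sphere_obj (P : lmodType R) :
  projective P -> forall n, projective (sphere_obj P n).
Proof.
move=> pP n; have [->|n0] := eqVneq n 0; first exact: pP.
exact: (projective_triv (@sphere_triv P n n0)).
Qed.

Lemma FP_bounded_sphere (M : lmodType R) : FP_infty M -> FP_bounded (sphere M).
Proof.
move=> FPM; split=> [|n].
  exists 0, 0 => n h; apply: sphere_triv; apply: contra h => /eqP ->.
  by rewrite Order.POrderTheory.lexx.
have [->|n0] := eqVneq n 0; first exact: FPM.
exact: (FP_infty_triv (@sphere_triv M n n0)).
Qed.
End Sphere.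

Section SphereCover.
Variables (R : pzRingType) (P M : lmodType R) (f : {linear P -> M}).

(* The disc on P in degrees 0 and -1, mapping onto M in degree 0.              *)
Definition sphere_cover : chain_map (disc_sum (sphere_obj P)) (sphere M) :=
  disc_map (X := sphere M) (sphere_map f).

Let K := ker_complex sphere_cover.

Definition cover_top : {linear P -> disc_sum (sphere_obj P) 0} :=
  @lin_pair R P P (sphere_obj P (0 + 1)) idfun \0.

Definition cover_bot : {linear P -> disc_sum (sphere_obj P) (-1)} :=
  @lin_pair R P (sphere_obj P (-1)) P \0 idfun.

Lemma cover_top_bot p :
  cdiff (disc_sum (sphere_obj P)) 0 (-1) (cover_top p) = cover_bot p.
Proof. by congr pair; apply: (@tr_id _ (sphere_obj P) 0). Qed.

Lemma sphere_cover_top x : sphere_cover 0 x = f x.1.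
Proof. exact: addr0. Qed.

Lemma ker_top_subproof (k : ker_of f) : sphere_cover 0 ((cover_top \o ker_incl f) k) = 0.
Proof. by rewrite sphere_cover_top; apply: ker_inclP. Qed.

Definition ker_top : {linear ker_of f -> K 0} := ker_lift ker_top_subproof.

Lemma ker_bot_subproof p : sphere_cover (-1) (cover_bot p) = 0.
Proof. exact: thinmx0. Qed.

Definition ker_bot : {linear P -> K (-1)} := ker_lift ker_bot_subproof.

Lemma ker_proj_subproof (k : K 0) : f ((fst \o ker_incl (sphere_cover 0)) k) = 0.
Proof. by rewrite -sphere_cover_top; apply: ker_inclP. Qed.

Definition ker_proj : {linear K 0 -> ker_of f} := ker_lift ker_proj_subproof.

Lemma ker_proj_top k : ker_proj (ker_top k) = k.
Proof. exact: ker_incl_inj. Qed.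

Lemma ker_sphere_cover1_triv (k : K 1) : k = 0.
Proof.
apply: ker_incl_inj; rewrite raddf0; case: (ker_incl _ k) => x y.
by congr pair; apply: thinmx0.
Qed.
End SphereCover.

Section LevelComplexForward.
Variables (R : pzRingType) (L : complex R).
Hypothesis levelL : level_complex L.

(** Levelness is applied to a resolution of the sphere, which exists because the sphere is bounded
    with FP_oo components; independence of the cover then transfers the injectivity to the disc. *)
Lemma level_sphere_cover (P M : lmodType R^c) (f : {linear P -> M}) :
  FP_infty M -> projective P -> surjection f -> bar_flat_kernel (sphere_cover f) L.
Proof.
move=> FPM pP fs; have FPS := FP_bounded_FP_infty (FP_bounded_sphere FPM).
have [Q _] := FPS.
apply: (@bar_flat_kernel_indep _ _ _ _ _ (cres_aug Q)).
- exact/projective_disc_sum/projective_sphere_obj.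
- exact: cres_proj.
- exact/disc_map_surj/sphere_map_surj.
- exact: cres_aug_surj.
- by move=> n; have [h _] := @barTor1_inj R _ L Q n; apply: h; apply: (levelL FPS).
Qed.

Let Rr : lmodType R^c := R^c^o.

Lemma projective_regular : projective Rr.
Proof.
move=> A B g f gs; have [a aE] := gs (f 1).
have hl : linear (fun r : Rr => (r : R^c) *: a).
  by move=> c x y; rewrite scalerDl scalerA.
exists (mk_linear hl) => x.
by rewrite linearZ /= aE -linearZ; congr (f _); apply: mulr1.
Qed.

Lemma fin_gen_regular : fin_gen Rr.
Proof.
exists 1%N, (fun=> 1) => x; exists (fun=> x).
by rewrite big_ord1; apply/esym/mulr1.
Qed.

Lemma FP_infty_regular : FP_infty Rr.
Proof.
have Z0 (x : 'rV[R^c]_0) : x = 0 by apply: thinmx0.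
pose P k : lmodType R^c := if k is 0%N then Rr else 'rV[R^c]_0.
unshelve eexists (@Resolution _ Rr P (fun=> \0) idfun _ _ _ _).
- by case=> [|k]; [apply: projective_regular|apply: projective_triv].
- by move=> x; exists x.
- by move=> x; split=> [x0|[y <-]//]; exists 0; exact/esym.
- by move=> k x; split=> // _; exists 0; rewrite (Z0 x).
- by case=> [|k]; [apply: fin_gen_regular|apply: fin_gen_triv].
Qed.

(** For the identity cover of R the kernel complex is R in degree -1, so its modified tensor product
    with L is a shift of L modulo boundaries. If dx = 0, then 1 (x) x with 1 in degree -1 is the
    boundary of 1 (x) x with 1 in degree 0 of the disc, so injectivity makes x a boundary. *)
Lemma level_complex_exact : exact_complex L.
Proof.
move=> n x dx; pose ir : {linear Rr -> Rr} := idfun; pose S := sphere_cover ir.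
pose bd (y : L n) := exists w, cdiff L (n + 1) n w = y.
have n1 : -1 + n = n - 1 by rewrite addrC.
have ids : surjection ir by move=> y; exists y.
have flat := level_sphere_cover FP_infty_regular projective_regular ids.
pose z : ct_obj (ker_complex S) L (n - 1) :=
  ct_in (n - 1) (tens (ker_bot ir 1) x).
have z0 : zpi (ct_boundary _ _ _) z = 0.
  apply: flat; rewrite bt_mapE ct_mapE.
  have -> : ker_cincl S (-1) (ker_bot ir 1) = cdiff _ 0 (-1) (cover_top Rr 1).
    exact/esym/cover_top_bot.
  have := bt_pi_diff (ct_in (n - 1 + 1) (tens (cover_top Rr 1) x)).
  rewrite /ct_diff /= (@ct_dl_in _ _ _ _ _ _ (-1)) // tensor_mapE.
  rewrite (@ct_dr_in _ _ _ _ _ _ (n - 1)) ?subrK // tensor_mapE dx.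
  by rewrite tens0r raddf0 mul0rz addr0.
(* Multiplication by the coefficient of the degree -1 generator: it induces a map to L_n modulo
   boundaries that sends [z] to the class of x. *)
pose b (k : ker_complex S (-1)) (y : L n) : zquot bd :=
  zpi bd (((ker_incl (S (-1)) k).2 : R) *: y).
have bDl m m' y : b (m + m') y = b m y + b m' y.
  by rewrite /b raddfD /= scalerDl raddfD.
have bDr m y y' : b m (y + y') = b m y + b m y'.
  by rewrite /b scalerDr raddfD.
have bZ (r : R) m y : b ((r : R^c) *: m) y = b m (r *: y).
  by rewrite /b linearZ /= scalerA.
pose g : {additive _ -> _} := tensor_lift bDl bDr bZ.
have gl k y : g (tens (cdiff (ker_complex S) (-1 + 1) (-1) k) y) = 0.
  apply: etrans (tensor_liftE _ _ _ _ _) _.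
  have k0 : (ker_incl (S 0) k).1 = 0.
    by rewrite -[LHS](sphere_cover_top ir) ker_inclP.
  have d0 : (ker_incl (S (-1)) (cdiff (ker_complex S) (-1 + 1) (-1) k)).2 = 0.
    by apply: etrans k0; apply: (@tr_id _ (sphere_obj Rr) 0).
  by rewrite /b d0 scale0r raddf0.
have gr k y : g (tens k (cdiff L (n + 1) n y)) = 0.
  apply: etrans (tensor_liftE _ _ _ _ _) _.
  apply/zpi_gen; exists (((ker_incl (S (-1)) k).2 : R) *: y).
  by rewrite linearZ_LR.
have := bt_pi_eq0_proj n1 gl gr z0.
rewrite ct_proj_tens // !tr_id => /(etrans (esym (tensor_liftE _ _ _ _ _))).
rewrite /b /= scale1r => /zpi_eq0P; apply: (in_zspan_closed (H := bd)) => //.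
  by exists 0; rewrite raddf0.
by move=> ? ? [u <-] [v <-]; exists (u - v); rewrite raddfB.
Qed.

End LevelComplexForward.

Section CycleQuotient.
Variables (R : pzRingType) (L : complex R).

Lemma exact_complexP n m x : exact_complex L -> n = m + 1 -> cdiff L n m x = 0 ->
  exists y : L (n + 1), cdiff L (n + 1) n y = x.
Proof.
move=> Lex nm; have e : m = n - 1 by rewrite nm addrK.
by subst m; apply: Lex.
Qed.
Lemma to_cycle_subproof n y : cdiff L n (n - 1) (cdiff L (n + 1) n y) = 0.
Proof. exact: cdiffK. Qed.

(** When L is exact, this is the surjection in 0 -> Z_(n+1) -> L_(n+1) -> Z_n -> 0. *)
Definition to_cycle n : {linear L (n + 1) -> cycle_module L n} :=
  ker_lift (@to_cycle_subproof n).

Lemma to_cycle_surj n : exact_complex L -> surjection (to_cycle n).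
Proof.
move=> Lex k; have [y yE] := Lex n (ker_incl _ k) (ker_inclP k).
by exists y; apply: ker_incl_inj; rewrite ker_liftE.
Qed.

Lemma to_cycle_eq0 n y : to_cycle n y = 0 <-> cdiff L (n + 1) n y = 0.
Proof.
split=> [/(congr1 (ker_incl _))|dy]; first by rewrite ker_liftE raddf0.
by apply: ker_incl_inj; rewrite ker_liftE dy raddf0.
Qed.
End CycleQuotient.

(* With f : P0 -> M and K its kernel complex, an element z of ker f (x) Z_n    *)
(* killed in P0 (x) Z_n lifts to y in ker f (x) L_(n+1), whose image in        *)
(* P0 (x) L_(n+1) is (1 (x) d) w.  Then y in degree 0 plus w in degree -1      *)
(* becomes the boundary of w in the disc, so it vanishes in the modified       *)
(* tensor product, which recovers z.                                           *)
Lemma level_complex_cycle (R : pzRingType) (L : complex R) (n : int) :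
  level_complex L -> level_module (cycle_module L n).
Proof.
move=> levelL M FPM P; apply/Tor1_inj => z fz.
have Lex := level_complex_exact levelL.
set f := res_aug P in z fz *; pose S := sphere_cover f.
have flat := level_sphere_cover levelL FPM (@res_proj _ _ P 0) (@res_aug_surj _ _ P).
have ids (T : Type) : surjection (@id T) by move=> y; exists y.
have qs := @to_cycle_surj _ _ n Lex.
have [y yz] := tensor_map_surj (f := idfun) (ids _) qs z.
have [w wE] : exists w : tensor (P 0%N) (L (n + 1 + 1)),
    tensor_map idfun (cdiff L (n + 1 + 1) (n + 1)) w = tensor_map (ker_incl f) idfun y.
  apply: (tensor_rexact_r qs) => [x /to_cycle_eq0|]; first exact: exact_complexP.
  transitivity (tensor_map (ker_incl f) idfun z); last exact: fz.
  by rewrite -yz; apply: tensor_map_comm.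
have m1 : -1 + (n + 1 + 1) = n + 1 by rewrite addrC addrK.
pose u : ct_obj (ker_complex S) L (n + 1) := ct_in (n + 1) (tensor_map (ker_top f) idfun y).
pose v : ct_obj (ker_complex S) L (n + 1) := ct_in (n + 1) (tensor_map (ker_bot f) idfun w).
pose D := disc_sum (sphere_obj (P 0%N)).
pose t : tensor (D 0) (L (n + 1 + 1)) := tensor_map (cover_top (P 0%N)) idfun w.
have tu : tensor_map (ker_cincl S 0) idfun (tensor_map (ker_top f) idfun y) =
    tensor_map idfun (cdiff L (n + 1 + 1) (n + 1)) t.
  transitivity (tensor_map (cover_top (P 0%N)) idfun
    (tensor_map (ker_incl f) (idfun : {linear L (n + 1) -> _}) y)).
    exact: tensor_map_comm.
  by rewrite -wE; apply: tensor_map_comm.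
have tv : tensor_map (ker_cincl S (-1)) idfun (tensor_map (ker_bot f) idfun w) =
    tensor_map (cdiff D 0 (-1)) idfun t.
  by apply: tensor_map_comm => // p; apply/esym/cover_top_bot.
(* In the disc, u + v is the boundary of t; t has left degree 0, so the second half of its
   differential carries the sign 1. *)
have z0 : zpi (ct_boundary _ _ _) (u + v) = 0.
  apply: flat; rewrite bt_mapE raddfD /= !ct_map_in tu tv.
  have := bt_pi_diff (ct_in (n + 1 + 1) t).
  rewrite /ct_diff /= (@ct_dl_in _ _ _ _ _ _ (-1)) // (@ct_dr_in _ _ _ _ _ _ (n + 1)) //.
  by rewrite mulr1z; apply: etrans; congr (zpi _ _); apply: addrC.
(* This kills boundaries because the kernel complex is zero in degree 1 and [to_cycle] vanishes on
   boundaries; it sends y in degree 0 back to z. *)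
pose g : {additive _ -> _} := tensor_map (ker_proj f) (to_cycle L n).
have gl k x : g (tens (cdiff (ker_complex S) (0 + 1) 0 k) x) = 0.
  have k0 : k = 0 := ker_sphere_cover1_triv k.
  by rewrite k0 raddf0 tens0l raddf0.
have gr k x : g (tens k (cdiff L (n + 1 + 1) (n + 1) x)) = 0.
  apply: etrans (tensor_mapE _ _ _ _) _.
  have -> : to_cycle L n (cdiff L (n + 1 + 1) (n + 1) x) = 0.
    exact/to_cycle_eq0/cdiffK.
  exact: tens0r.
have pu : ct_proj 0 (n + 1) u = tensor_map (ker_top f) idfun y.
  by rewrite ct_projE ?add0r // tensor_map_id // => x; apply: tr_id.
have pv : ct_proj 0 (n + 1) v = 0.
  by rewrite ct_projE ?add0r // tensor_map0 // => p x; rewrite /= tr_neq ?tens0l.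
have := bt_pi_eq0_proj (add0r _) gl gr z0.
rewrite [ct_proj _ _ _]raddfD /= pu pv addr0 => gz; rewrite -yz -gz.
by apply/esym/tensor_map_comp => // x; apply: ker_proj_top.
Qed.

(** * Exact complexes with level cycles are level *)

Section FlatProjective.
Variables (R : pzRingType) (P : lmodType R^c) (N N' : lmodType R).

(** A dual basis gives maps phi_k : P (x) V -> V, natural in V, with z = sum of g_k (x) phi_k(z). If
    z dies in P (x) N', each phi_k(z) is killed by [i], hence zero. *)
Lemma fg_projective_flat (i : {linear N -> N'}) :
  projective P -> fin_gen P -> (forall y, i y = 0 -> y = 0) ->
  forall z, tensor_map (idfun : {linear P -> P}) i z = 0 -> z = 0.
Proof.
move=> pP fP i0; have [n [g [c [cD cZ gc]]]] := dual_basis pP fP.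
pose b (V : lmodType R) k p (y : V) := (c k p : R) *: y.
have bDl (V : lmodType R) k p p' (y : V) : b V k (p + p') y = b V k p y + b V k p' y.
  by rewrite /b cD scalerDl.
have bDr (V : lmodType R) k p (y y' : V) : b V k p (y + y') = b V k p y + b V k p y'.
  by rewrite /b scalerDr.
have bZ (V : lmodType R) k (r : R) p (y : V) : b V k ((r : R^c) *: p) y = b V k p (r *: y).
  by rewrite /b cZ scalerA.
pose phi (V : lmodType R) k : {additive tensor P V -> V} :=
  tensor_lift (bDl V k) (bDr V k) (bZ V k).
have phiE V k p y : phi V k (tens p y) = (c k p : R) *: y by apply: tensor_liftE.
have phi_nat k z : phi N' k (tensor_map idfun i z) = i (phi N k z).
  elim/tensor_ind: z => [|y z yE zE|p y]; first by rewrite !raddf0.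
    by rewrite !raddfB /= yE zE.
  by rewrite tensor_mapE !phiE linearZ_LR.
have phi_sum z : z = \sum_(k < n) tens (g k) (phi N k z).
  elim/tensor_ind: z => [|y z yE zE|p y].
  - by rewrite big1 // => k _; rewrite raddf0 tens0r.
  - rewrite {1}yE {1}zE -sumrB; apply: eq_bigr => k _.
    by rewrite -tensBr -raddfB.
  - have tens_suml (s : 'I_n -> P) : tens (\sum_k s k) y = \sum_k tens (s k) y.
      exact: (big_morph (fun p => tens p y) (fun p p' => tensDl p p' y) (tens0l _ y)).
    rewrite {1}[p]gc tens_suml; apply: eq_bigr => k _.
    by rewrite phiE (tensZ (c k p : R)).
move=> z iz; rewrite [z]phi_sum big1 // => k _.
by rewrite (i0 (phi N k z)) ?tens0r // -phi_nat iz raddf0.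
Qed.
End FlatProjective.

(** * Tor_1 along a short exact sequence in the second variable *)

Section TorBalance.
Variables (R : pzRingType) (P M : lmodType R^c) (f : {linear P -> M}).
Variables (Z L Z' : lmodType R) (i : {linear Z -> L}) (q : {linear L -> Z'}).
Hypotheses (fs : surjection f) (pP : projective P) (fP : fin_gen P).
Hypotheses (i0 : forall y, i y = 0 -> y = 0) (qs : surjection q).
Hypothesis qi : forall y, q y = 0 <-> exists x, i x = y.
Hypothesis injZ' : forall z : tensor (ker_of f) Z',
  tensor_map (ker_incl f) idfun z = 0 -> z = 0.

Let qi0 y : q (i y) = 0. Proof. by apply/qi; exists y. Qed.

Let ker_exact x : f x = 0 -> exists y, ker_incl f y = x.
Proof. exact: ker_of_eta. Qed.

(** The chase in the grid with rows K, P and columns Z, L, Z': injectivity over Z' puts k in the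
    image of K (x) Z, and flatness of P identifies the image of the lift in P (x) Z with p. *)
Let lift_to_Z (k : tensor (ker_of f) L) (p : tensor P Z) :
  tensor_map (ker_incl f) idfun k = tensor_map idfun i p ->
  exists2 w : tensor (ker_of f) Z, tensor_map idfun i w = k &
    tensor_map (ker_incl f) idfun w = p.
Proof.
move=> kp.
have qk : tensor_map (idfun : {linear ker_of f -> _}) q k = 0.
  apply: injZ'.
  transitivity (tensor_map (idfun : {linear P -> _}) q (tensor_map (ker_incl f) idfun k)).
    exact: tensor_map_comm.
  rewrite kp (tensor_map_comp (f'' := idfun) (g'' := \0) _ qi0) //.
  by apply: tensor_map0 => x y; apply: tens0r.
have [w wk] : exists w, tensor_map (idfun : {linear ker_of f -> _}) i w = k.
  by apply: (tensor_rexact_r qs) qk => y /qi.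
exists w => //; apply/eqP; rewrite -subr_eq0; apply/eqP.
apply: (fg_projective_flat pP fP i0); rewrite raddfB /=.
apply/eqP; rewrite subr_eq0 -kp -wk; apply/eqP.
exact: tensor_map_comm.
Qed.

(** Balance of Tor: Tor_1(M, Z') = 0, known through a cover of M, is read off from the sequence Z ->
    L -> Z' instead. *)
Lemma tensor_mono_of_Tor1 (z : tensor M Z) : tensor_map idfun i z = 0 -> z = 0.
Proof.
have [p <-] := tensor_map_surj (f := f) (g := idfun) fs (fun y => ex_intro _ y erefl) z.
move=> iz; have fp : tensor_map f idfun (tensor_map (idfun : {linear P -> P}) i p) = 0.
  by rewrite -[RHS]iz; apply: tensor_map_comm.
have [k kp] := tensor_rexact_l fs ker_exact fp.
have [w _ <-] := lift_to_Z kp.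
rewrite (tensor_map_comp (f'' := \0) (g'' := idfun)) // => [|x].
  by apply: tensor_map0 => x y; apply: tens0l.
exact: ker_inclP.
Qed.

(** Vanishing of Tor_1(M, -) passes to extensions; this is the chase above with p = 0. *)
Lemma ker_mono_extension :
  (forall z : tensor (ker_of f) Z, tensor_map (ker_incl f) idfun z = 0 -> z = 0) ->
  forall z : tensor (ker_of f) L, tensor_map (ker_incl f) idfun z = 0 -> z = 0.
Proof.
move=> injZ z fz; have [|w <- /injZ ->] := @lift_to_Z z 0; last exact: raddf0.
by rewrite fz raddf0.
Qed.
End TorBalance.

Section BoundedRows.
Variables (R : pzRingType) (X : complex R^c) (L : complex R).
Hypothesis rows : forall i n (w : tensor (X i) (L (n + 1))),
  tensor_map idfun (cdiff L (n + 1) n) w = 0 ->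
  exists w' : tensor (X i) (L (n + 1 + 1)),
    tensor_map idfun (cdiff L (n + 1 + 1) (n + 1)) w' = w.
Variable a : int.
Hypothesis Xa : forall i, (i < a)%R -> forall x : X i, x = 0.

Lemma mulrz_sign_eq0 (A : zmodType) (x : A) k : x *~ (-1) ^+ k = 0 -> x = 0.
Proof.
rewrite -signr_odd; case: odd; rewrite ?expr1 ?expr0 ?mulr1z // mulrN1z.
by move/eqP; rewrite oppr_eq0 => /eqP.
Qed.

Lemma mulrz_signK (A : zmodType) (x : A) k : x *~ (-1) ^+ k *~ (-1) ^+ k = x.
Proof. by rewrite -mulrzA -expr2 sqrr_sign mulr1z. Qed.

(* The component of highest X-degree of a cycle is a cycle of its row, hence   *)
(* can be removed by subtracting a boundary.                                   *)
Lemma ctensor_exact_from k m (z : ct_obj X L (m + 1)) :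
  (forall i j, i + j = m + 1 -> (a + k%:Z <= i)%R -> ct_proj i j z = 0) ->
  ct_diff X L (m + 1) m z = 0 -> exists w, ct_diff X L (m + 1 + 1) (m + 1) w = z.
Proof.
elim: k z => [|k IH] z zk dz.
  have -> : z = 0; last by exists 0; rewrite raddf0.
  apply: ct_eq0 => i j ijm; have [ai|ia] := Order.TotalTheory.leP a i.
    by apply: zk; rewrite ?addr0.
  exact/tensor_trivl/Xa.
pose i := a + k%:Z; pose n := m - i.
have inm : i + n = m by rewrite addrC subrK.
have inm1 : i + (n + 1) = m + 1 by rewrite addrA inm.
have inm2 : i + (n + 1 + 1) = m + 1 + 1 by rewrite addrA inm1.
pose y := ct_proj i (n + 1) z.
have z0 j j' : j + j' = m + 1 -> (i < j)%R -> ct_proj j j' z = 0.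
  move=> jm ij; apply: zk => //.
  by move: ij; rewrite /i; lia.
have dy : tensor_map idfun (cdiff L (n + 1) n) y = 0.
  have := congr1 (ct_proj i n) dz.
  rewrite /ct_diff /= raddfD /= ct_proj_dl // ct_proj_dr // raddf0 z0.
  - by rewrite raddf0 add0r => /mulrz_sign_eq0.
  - by rewrite -inm addrAC.
  - by rewrite Num.Theory.ltrDl.
have [y' y'y] := rows dy.
(* The sign cancels the one in the differential, so the boundary of w has component y in left degree
   i; its only other component lies in left degree i - 1. *)
pose w : ct_obj X L (m + 1 + 1) := ct_in _ (y' *~ (-1) ^+ `|i|).
have wz j j' : j + j' = m + 1 -> (i <= j)%R ->
    ct_proj j j' (z - ct_diff X L (m + 1 + 1) (m + 1) w) = 0.
  move=> jm ij; rewrite raddfB /= /ct_diff /= raddfD /= ct_proj_dl // ct_proj_dr //.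
  rewrite !ct_projE ?addrA ?jm //; last by rewrite addrAC jm.
  rewrite [tensor_map (@tr _ _ i (j + 1)) _ _]tensor_map0 => [|x x']; last first.
    rewrite /= tr_neq ?tens0l //; apply: contraTneq ij => ->.
    by rewrite -Order.TotalTheory.ltNge Num.Theory.ltrDl.
  rewrite raddf0 add0r; have [ij'|nij] := eqVneq i j; last first.
    rewrite z0 //; last by rewrite Order.POrderTheory.lt_neqAle nij.
    rewrite [tensor_map (@tr _ _ i j) _ _]tensor_map0 => [|x x'].
      by rewrite raddf0 mul0rz subr0.
    by rewrite /= tr_neq ?tens0l.
  subst j; have e : j' = n + 1 by apply: (addrI i); rewrite jm inm1.
  subst j'; rewrite [tensor_map _ (@tr _ _ _ _) _]tensor_map_id => [|x|x];
    try exact: tr_id.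
  by rewrite [tensor_map _ _ (y' *~ _)]raddfMz /= y'y mulrz_signK subrr.
have [|w' w'E] := IH _ wz; first by rewrite raddfB /= dz ct_diffK subr0.
by exists (w' + w); rewrite raddfD /= w'E subrK.
Qed.

End BoundedRows.

Lemma ctensor_exact (R : pzRingType) (X : complex R^c) (L : complex R) :
  (forall i n (w : tensor (X i) (L (n + 1))),
    tensor_map idfun (cdiff L (n + 1) n) w = 0 ->
    exists w' : tensor (X i) (L (n + 1 + 1)),
      tensor_map idfun (cdiff L (n + 1 + 1) (n + 1)) w' = w) ->
  bounded_complex X -> forall m (z : ct_obj X L (m + 1)),
  ct_diff X L (m + 1) m z = 0 -> exists w, ct_diff X L (m + 1 + 1) (m + 1) w = z.
Proof.
move=> rows [a [b Xb]] m z dz.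
have Xa i : (i < a)%R -> forall x : X i, x = 0 by move=> ia; apply: Xb; lia.
(* With this k, a + k is at least b + 1 even when the interval is empty, so X vanishes from degree a
   + k on. *)
apply: (ctensor_exact_from rows Xa (k := absz (b + 1 - a)%R) _ dz) => i j _ abi.
by apply/tensor_trivl/Xb; lia.
Qed.

Section LevelComplexBackward.
Variables (R : pzRingType) (L : complex R).
Hypotheses (Lex : exact_complex L) (levelZ : forall n, level_module (cycle_module L n)).

Section Degree.
Variables (M : lmodType R^c) (P : resolution M).
Hypothesis Pfg : forall k, fin_gen (P k).

Let FPM : FP_infty M. Proof. by exists P. Qed.

Let injZ n (z : tensor (ker_of (res_aug P)) (cycle_module L n)) :
  tensor_map (ker_incl (res_aug P)) idfun z = 0 -> z = 0.
Proof.
by have [h _] := @Tor1_inj R M (cycle_module L n) P; apply: h; apply: (levelZ FPM).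
Qed.

Let incl_eq0 n k : ker_incl (cdiff L n (n - 1)) k = 0 -> k = 0.
Proof. by move=> k0; apply: ker_incl_inj; rewrite k0 raddf0. Qed.

Let cycle_exact n (y : L (n + 1)) : to_cycle L n y = 0 <->
  exists k, ker_incl (cdiff L (n + 1) (n + 1 - 1)) k = y.
Proof.
have e (y' : L (n + 1)) : cdiff L (n + 1) n y' = 0 <-> cdiff L (n + 1) (n + 1 - 1) y' = 0.
  by rewrite addrK.
split=> [/to_cycle_eq0/e/ker_of_eta//|[k <-]].
by apply/to_cycle_eq0/e/ker_inclP.
Qed.

(** L_n is an extension of Z_(n-1) by Z_n, and Tor_1(M, -) vanishes at both. *)
Lemma ker_aug_mono n (z : tensor (ker_of (res_aug P)) (L n)) :
  tensor_map (ker_incl (res_aug P)) idfun z = 0 -> z = 0.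
Proof.
move: z; rewrite -(subrK 1 n); move: (n - 1) => {}n.
apply: (ker_mono_extension (@res_proj _ _ P 0%N) (Pfg 0%N)
  (@incl_eq0 _) (@to_cycle_surj _ _ n Lex)).
- exact: cycle_exact.
- exact: injZ.
- exact: injZ.
Qed.

Lemma cycle_mono n (z : tensor M (cycle_module L n)) :
  tensor_map idfun (ker_incl (cdiff L n (n - 1))) z = 0 -> z = 0.
Proof.
move: z; rewrite -(subrK 1 n); move: (n - 1) => {}n.
apply: (tensor_mono_of_Tor1 (@res_aug_surj _ _ P) (@res_proj _ _ P 0%N) (Pfg 0%N)
  (@incl_eq0 _) (@to_cycle_surj _ _ n Lex)).
- exact: cycle_exact.
- exact: injZ.
Qed.

(** The differential factors through Z_n, and M (x) Z_n -> M (x) L_n is injective by [cycle_mono].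
    Hence w dies in M (x) Z_n, and right exactness applies. *)
Lemma tensor_row_exact n (w : tensor M (L (n + 1))) :
  tensor_map idfun (cdiff L (n + 1) n) w = 0 ->
  exists w' : tensor M (L (n + 1 + 1)),
    tensor_map idfun (cdiff L (n + 1 + 1) (n + 1)) w' = w.
Proof.
move=> dw; apply: (tensor_rexact_r (@to_cycle_surj _ _ n Lex)) => [x /to_cycle_eq0|].
  exact: exact_complexP.
apply: cycle_mono; rewrite -[RHS]dw; exact: tensor_map_comp.
Qed.
End Degree.

(* The long exact homology sequence of 0 -> K (x) L -> P (x) L -> X (x) L -> 0 *)
(* with X (x) L exact.                                                         *)
Lemma level_complex_of_cycles : level_complex L.
Proof.
move=> X FPX P n; apply/barTor1_inj => z.
have [Q Qfg] := FPX; pose e := cres_aug Q.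
have Qifg i k : fin_gen (obj_resolution Q i k) := (Qfg k).2 i.
suff flat : bar_flat_kernel e L.
  by move: z; apply: (bar_flat_kernel_indep _ _ _ _ flat);
    [exact: cres_proj|exact: cres_proj|exact: cres_aug_surj|exact: cres_aug_surj].
have rows i m w := @tensor_row_exact _ _ (Qifg i) m w.
have Xex := ctensor_exact rows (FP_infty_bounded FPX).
have es : chain_surjection e := @cres_aug_surj _ _ Q.
clear z; move=> {}n z; have [{}z <-] := zpi_surj z.
pose k := ker_cincl e.
rewrite bt_mapE -/k => /bt_pi_eq0[b bz].
have ek0 m (u : ct_obj (ker_complex e) L m) : ct_map e (ct_map k u) = 0.
  apply: ct_eq0 => i j ijm; rewrite !ct_proj_map //.
  rewrite (tensor_map_comp (f'' := \0) (g'' := idfun)) // => [|x]; last exact: ker_inclP.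
  by apply: tensor_map0 => x y; apply: tens0l.
(* The image of b in X (x) L is a cycle, because the boundary of b comes from the kernel. *)
have [c' c'E] : exists c', ct_diff X L (n + 1 + 1) (n + 1) c' = ct_map e b.
  apply: Xex; transitivity (ct_map e (ct_diff (Q 0%N) L (n + 1) n b)).
    exact: (esym (ct_map_comm e n b)).
  by rewrite bz ek0.
have [b' b'E] := ct_map_surj es c'.
(* Correcting b by a boundary makes it vanish in X (x) L without changing its own boundary, so it
   comes from K (x) L. *)
have [w wE] : exists w, ct_map k w = b - ct_diff (Q 0%N) L (n + 1 + 1) (n + 1) b'.
  apply: (ct_map_ker es) => [m x|]; first exact: ker_of_eta.
  apply/eqP; rewrite raddfB /= subr_eq0 -c'E -b'E; apply/eqP/esym.
  exact: (ct_map_comm e (n + 1) b').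
have kw : ct_map k (ct_diff (ker_complex e) L (n + 1) n w) = ct_map k z.
  transitivity (ct_diff (Q 0%N) L (n + 1) n (ct_map k w)); first exact: (ct_map_comm k n w).
  by rewrite wE raddfB /= ct_diffK subr0.
suff -> : z = ct_diff (ker_complex e) L (n + 1) n w by apply: bt_pi_diff.
apply/eqP; rewrite -subr_eq0; apply/eqP.
apply: (ct_map_inj (f := k)) => [i j|].
  exact: (ker_aug_mono (Qifg i)).
by rewrite raddfB /= kw subrr.
Qed.
End LevelComplexBackward.

Theorem proposition4p6 (R : pzRingType) (L : complex R) :
  level_complex L <->
  exact_complex L /\ forall n : int, level_module (cycle_module L n).
Proof.
split=> [levelL|[Lex levelZ]]; last exact: level_complex_of_cycles.
by split=> [|n]; [exact: level_complex_exact|exact: level_complex_cycle].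
Qed.
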